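(* (1) The maps $\sigma:\mathbf{Ext}(\mathtt{bi\text{-}IPC_R})\to\mathbf{NExt}(\mathtt{GRZ.T_R})$, $\sigma\mathtt{L}=\mathtt{GRZ.T_R}\oplus\{T(\Gamma/\Delta):\Gamma/\Delta\in\mathtt{L}\}$, and $\rho:\mathbf{NExt}(\mathtt{GRZ.T_R})\to\mathbf{Ext}(\mathtt{bi\text{-}IPC_R})$, $\rho\mathtt{M}=\{\Gamma/\Delta:T(\Gamma/\Delta)\in\mathtt{M}\}$, are complete lattice isomorphisms and mutual inverses. (2) The maps $\sigma:\mathbf{Ext}(\mathtt{bi\text{-}IPC})\to\mathbf{NExt}(\mathtt{GRZ.T})$, $\sigma\mathtt{L}=\mathtt{GRZ.T}\oplus\{T\varphi:\varphi\in\mathtt{L}\}$, and $\rho:\mathbf{NExt}(\mathtt{GRZ.T})\to\mathbf{Ext}(\mathtt{bi\text{-}IPC})$, $\rho\mathtt{M}=\{\varphi:T\varphi\in\mathtt{M}\}$, are complete lattice isomorphisms and mutual inverses.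
   Context: $\mathbf{Ext}(\mathtt{bi\text{-}IPC})$: lattice of bsi-logics (substitution-closed sets of formulae over $\{\land,\lor,\to,\leftarrow,\bot,\top\}$ containing bi-intuitionistic logic $\mathtt{bi\text{-}IPC}$, closed under modus ponens and $\varphi\mapsto\neg(\varphi\leftarrow\top)$). $\mathbf{Ext}(\mathtt{bi\text{-}IPC_R})$: lattice of bsi-rule systems (sets of pairs $\Gamma/\Delta$ of finite sets of formulae closed under substitution, reflexivity, weakening on both sides and cut, containing $/\varphi$ for $\varphi\in\mathtt{bi\text{-}IPC}$, $\varphi,\varphi\to\psi/\psi$, $\varphi/\neg(\varphi\leftarrow\top)$). Tense logics: substitution-closed sets over $\{\land,\lor,\neg,\square_F,\lozenge_P,\bot,\top\}$ containing $\mathtt{S4.t}$ (least normal tense logic with $\mathtt{S4}$ for $\square_F$ and for $\square_P=\neg\lozenge_P\neg$ and $\varphi\to\square_F\lozenge_P\varphi$), closed under modus ponens and necessitation for $\square_F$ and $\square_P$; tense rule systems analogously contain $/\varphi$ for $\varphi\in\mathtt{S4.t}$ and the rules $\varphi,\varphi\to\psi/\psi$, $\varphi/\square_F\varphi$, $\varphi/\square_P\varphi$. $\mathtt{GRZ.T}=\mathtt{S4.t}\oplus\square_F(\square_F(p\to\square_Fp)\to p)\to p\oplus p\to\lozenge_P(p\land\neg\lozenge_P(\lozenge_Pp\land\neg p))$, $\mathtt{GRZ.T_R}$ the least tense rule system containing $/\varphi$ for its theorems; $\mathbf{NExt}(\mathtt{X})$ is the set of tense logics (resp. rule systems) extending $\mathtt{X}$.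 Meets are intersections, joins $\oplus$ are least logics/rule systems of the relevant kind containing the sets. Translation $T$: $T(p)=\square_Fp$, $T(\bot)=\bot,T(\top)=\top$, commutes with $\land,\lor$, $T(\varphi\to\psi)=\square_F(\neg T\varphi\lor T\psi)$, $T(\varphi\leftarrow\psi)=\lozenge_P(T\varphi\land\neg T\psi)$, $T(\Gamma/\Delta)=T[\Gamma]/T[\Delta]$.
   Formalization: The bsi rule φ/¬(φ←⊤), vacuous under the given T, is read as φ/¬(⊤←φ) for logics and rule systems; normal tense logics are taken to contain also the converse axiom φ→□_P◇_Fφ; without these, ρ is not onto, respectively not well defined. *)

(* Defs.v *)
(* Logics and rule systems are classical sets; the premises and conclusions of
   a rule are finite sets {fset _}. *)
From HB Require Import structures.
From mathcomp Require Export all_boot finmap boolp classical_sets functions.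

Set Implicit Arguments.
Unset Strict Implicit.
Unset Printing Implicit Defensive.

Local Open Scope classical_set_scope.

(* Bi-superintuitionistic formulae. [Coimp p q] is p <- q, "p excludes q":
   the adjunction reads  p <- q <= r  iff  p <= q \/ r. *)
Inductive bform : Type :=
| BVar of nat
| BBot
| BTop
| BAnd of bform & bform
| BOr of bform & bform
| Imp of bform & bform
| Coimp of bform & bform.

(* [DiaP] is primitive; the other tense modalities are derived from it and
   from [BoxF] below. *)
Inductive tform : Type :=
| TVar of nat
| TBot
| TTop
| TAnd of tform & tform
| TOr of tform & tform
| Not of tform
| BoxF of tform
| DiaP of tform.

Fixpoint bform_encode (p : bform) : GenTree.tree nat :=
  match p with
  | BVar n => GenTree.Leaf n
  | BBot => GenTree.Node 0 [::]
  | BTop => GenTree.Node 1 [::]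
  | BAnd p q => GenTree.Node 2 [:: bform_encode p; bform_encode q]
  | BOr p q => GenTree.Node 3 [:: bform_encode p; bform_encode q]
  | Imp p q => GenTree.Node 4 [:: bform_encode p; bform_encode q]
  | Coimp p q => GenTree.Node 5 [:: bform_encode p; bform_encode q]
  end.

Fixpoint bform_decode (t : GenTree.tree nat) : bform :=
  match t with
  | GenTree.Leaf n => BVar n
  | GenTree.Node 1 _ => BTop
  | GenTree.Node 2 [:: t; u] => BAnd (bform_decode t) (bform_decode u)
  | GenTree.Node 3 [:: t; u] => BOr (bform_decode t) (bform_decode u)
  | GenTree.Node 4 [:: t; u] => Imp (bform_decode t) (bform_decode u)
  | GenTree.Node 5 [:: t; u] => Coimp (bform_decode t) (bform_decode u)
  | _ => BBot
  end.

Lemma bform_encodeK : cancel bform_encode bform_decode.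
Proof. by elim=> //= p -> q ->. Qed.

HB.instance Definition _ := Countable.copy bform (can_type bform_encodeK).

Fixpoint tform_encode (p : tform) : GenTree.tree nat :=
  match p with
  | TVar n => GenTree.Leaf n
  | TBot => GenTree.Node 0 [::]
  | TTop => GenTree.Node 1 [::]
  | TAnd p q => GenTree.Node 2 [:: tform_encode p; tform_encode q]
  | TOr p q => GenTree.Node 3 [:: tform_encode p; tform_encode q]
  | Not p => GenTree.Node 4 [:: tform_encode p]
  | BoxF p => GenTree.Node 5 [:: tform_encode p]
  | DiaP p => GenTree.Node 6 [:: tform_encode p]
  end.

Fixpoint tform_decode (t : GenTree.tree nat) : tform :=
  match t with
  | GenTree.Leaf n => TVar n
  | GenTree.Node 1 _ => TTop
  | GenTree.Node 2 [:: t; u] => TAnd (tform_decode t) (tform_decode u)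
  | GenTree.Node 3 [:: t; u] => TOr (tform_decode t) (tform_decode u)
  | GenTree.Node 4 [:: t] => Not (tform_decode t)
  | GenTree.Node 5 [:: t] => BoxF (tform_decode t)
  | GenTree.Node 6 [:: t] => DiaP (tform_decode t)
  | _ => TBot
  end.

Lemma tform_encodeK : cancel tform_encode tform_decode.
Proof. by elim=> //= [p -> q ->|p -> q ->|p ->|p ->|p ->]. Qed.

HB.instance Definition _ := Countable.copy tform (can_type tform_encodeK).

Definition bneg (p : bform) : bform := Imp p BBot.
Definition bconeg (p : bform) : bform := Coimp BTop p.

Definition timp (p q : tform) : tform := TOr (Not p) q.
Definition tiff (p q : tform) : tform := TAnd (timp p q) (timp q p).
Definition DiaF (p : tform) : tform := Not (BoxF (Not p)).
Definition BoxP (p : tform) : tform := Not (DiaP (Not p)).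

Fixpoint bsubst (s : nat -> bform) (p : bform) : bform :=
  match p with
  | BVar n => s n
  | BBot => BBot
  | BTop => BTop
  | BAnd p q => BAnd (bsubst s p) (bsubst s q)
  | BOr p q => BOr (bsubst s p) (bsubst s q)
  | Imp p q => Imp (bsubst s p) (bsubst s q)
  | Coimp p q => Coimp (bsubst s p) (bsubst s q)
  end.

Fixpoint tsubst (s : nat -> tform) (p : tform) : tform :=
  match p with
  | TVar n => s n
  | TBot => TBot
  | TTop => TTop
  | TAnd p q => TAnd (tsubst s p) (tsubst s q)
  | TOr p q => TOr (tsubst s p) (tsubst s q)
  | Not p => Not (tsubst s p)
  | BoxF p => BoxF (tsubst s p)
  | DiaP p => DiaP (tsubst s p)
  end.

(* [oplus C X Y] is X (+) Y computed among the sets satisfying [C]. *)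
Definition oplus (U : Type) (C : set (set U)) (X Y : set U) : set U :=
  smallest C (X `|` Y).

Definition meet (U : Type) (F : set (set U)) : set U := \bigcap_(L in F) L.

Definition join (U : Type) (C : set (set U)) (F : set (set U)) : set U :=
  smallest C (\bigcup_(L in F) L).

(* [C] and [D] are the carriers of complete lattices of sets ordered by
   inclusion, with the meets and joins above; the families are arbitrary,
   possibly empty. *)
Definition complete_lattice_isomorphism (U V : Type)
    (C : set (set U)) (D : set (set V)) (f : set U -> set V) : Prop :=
  [/\ set_bij C D f,
      forall F : set (set U), F `<=` C -> f (meet F) = meet (f @` F) &
      forall F : set (set U), F `<=` C -> f (join C F) = join D (f @` F)].

(* Hilbert axioms of intuitionistic logic, followed by those for coimplication
   (Rauszer); with modus ponens and p / ~(T <- p) they yield the adjunction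
   p <- q <= r  iff  p <= q \/ r. With p <- q read as "p excludes q", as the
   translation [Tr] below requires, the rule has to be p / ~(T <- p): the
   formula ~(p <- T) is a theorem for every p. *)
Inductive biIPC_axiom : set bform :=
| BAxK p q : biIPC_axiom (Imp p (Imp q p))
| BAxS p q r :
    biIPC_axiom (Imp (Imp p (Imp q r)) (Imp (Imp p q) (Imp p r)))
| BAxAndE1 p q : biIPC_axiom (Imp (BAnd p q) p)
| BAxAndE2 p q : biIPC_axiom (Imp (BAnd p q) q)
| BAxAndI p q : biIPC_axiom (Imp p (Imp q (BAnd p q)))
| BAxOrI1 p q : biIPC_axiom (Imp p (BOr p q))
| BAxOrI2 p q : biIPC_axiom (Imp q (BOr p q))
| BAxOrE p q r :
    biIPC_axiom (Imp (Imp p r) (Imp (Imp q r) (Imp (BOr p q) r)))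
| BAxBot p : biIPC_axiom (Imp BBot p)
| BAxTop p : biIPC_axiom (Imp p BTop)
| BAxCoimpI p q : biIPC_axiom (Imp p (BOr q (Coimp p q)))
| BAxCoimpImp p q : biIPC_axiom (Imp (Coimp p q) (bconeg (Imp p q)))
| BAxCoimpOr p q r :
    biIPC_axiom (Imp (Coimp (Coimp p q) r) (Coimp p (BOr q r)))
| BAxCoimpNeg p q : biIPC_axiom (Imp (bneg (Coimp p q)) (Imp p q)).

Definition bsi_closed (L : set bform) : Prop :=
  [/\ forall s p, L p -> L (bsubst s p),
      forall p q, L p -> L (Imp p q) -> L q &
      forall p, L p -> L (bneg (bconeg p))].

Definition biIPC : set bform := smallest bsi_closed biIPC_axiom.

Definition bsi_logic (L : set bform) : Prop :=
  bsi_closed L /\ biIPC `<=` L.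

(* Truth-functional evaluation in which formulae headed by a modality count as
   atoms. *)
Fixpoint teval (v : tform -> bool) (p : tform) : bool :=
  match p with
  | TBot => false
  | TTop => true
  | TAnd p q => teval v p && teval v q
  | TOr p q => teval v p || teval v q
  | Not p => ~~ teval v p
  | TVar _ | BoxF _ | DiaP _ => v p
  end.

Definition tautology (p : tform) : Prop := forall v, teval v p.

(* The minimal normal tense logic: [KtDual] is what normality of the primitive
   possibility operator DiaP amounts to, and the last two axioms say that F and
   P are converse to each other. *)
Inductive Kt_axiom : set tform :=
| KtTaut p : tautology p -> Kt_axiom p
| KtKF p q : Kt_axiom (timp (BoxF (timp p q)) (timp (BoxF p) (BoxF q)))
| KtKP p q : Kt_axiom (timp (BoxP (timp p q)) (timp (BoxP p) (BoxP q)))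
| KtDual p : Kt_axiom (tiff (DiaP p) (Not (BoxP (Not p))))
| KtFP p : Kt_axiom (timp p (BoxF (DiaP p)))
| KtPF p : Kt_axiom (timp p (BoxP (DiaF p))).

Definition tense_closed (M : set tform) : Prop :=
  [/\ forall s p, M p -> M (tsubst s p),
      forall p q, M p -> M (timp p q) -> M q,
      forall p, M p -> M (BoxF p) &
      forall p, M p -> M (BoxP p)].

Definition normal_tense_logic (M : set tform) : Prop :=
  tense_closed M /\ Kt_axiom `<=` M.

Inductive S4_axiom : set tform :=
| S4TF p : S4_axiom (timp (BoxF p) p)
| S44F p : S4_axiom (timp (BoxF p) (BoxF (BoxF p)))
| S4TP p : S4_axiom (timp (BoxP p) p)
| S44P p : S4_axiom (timp (BoxP p) (BoxP (BoxP p))).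

Definition S4t : set tform := smallest normal_tense_logic S4_axiom.

Definition tense_logic (M : set tform) : Prop :=
  tense_closed M /\ S4t `<=` M.

Definition grzF : tform :=
  let p := TVar 0 in
  timp (BoxF (timp (BoxF (timp p (BoxF p))) p)) p.

Definition grzP : tform :=
  let p := TVar 0 in
  timp p (DiaP (TAnd p (Not (DiaP (TAnd (DiaP p) (Not p)))))).

Definition GRZT : set tform := oplus tense_logic S4t [set grzF; grzP].

Definition NExt (X : set tform) : set (set tform) :=
  [set M | tense_logic M /\ X `<=` M].

(* The pair (G, D) is the rule G / D. *)
Definition rule (A : choiceType) : Type := ({fset A} * {fset A})%type.

Definition map_rule (A B : choiceType) (f : A -> B) (r : rule A) : rule B :=
  ([fset f p | p in r.1]%fset, [fset f p | p in r.2]%fset).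

Definition rule_system (A : choiceType) (sub : (nat -> A) -> A -> A)
    (S : set (rule A)) : Prop :=
  [/\ forall s r, S r -> S (map_rule (sub s) r),
      forall p, S ([fset p], [fset p])%fset,
      forall G D G' D', S (G, D) -> S (G `|` G', D `|` D')%fset &
      forall G D p, S (G, p |` D)%fset -> S (p |` G, D)%fset -> S (G, D)].

(* The rule / p without premises. *)
Definition theorem_rule (A : choiceType) (p : A) : rule A :=
  (fset0, [fset p])%fset.

Definition bsi_rule_system (L : set (rule bform)) : Prop :=
  [/\ rule_system bsubst L,
      [set @theorem_rule bform p | p in biIPC] `<=` L,
      forall p q, L ([fset p; Imp p q], [fset q])%fset &
      forall p, L ([fset p], [fset bneg (bconeg p)])%fset].

Definition tense_rule_system (M : set (rule tform)) : Prop :=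
  [/\ rule_system tsubst M,
      [set @theorem_rule tform p | p in S4t] `<=` M,
      forall p q, M ([fset p; timp p q], [fset q])%fset,
      forall p, M ([fset p], [fset BoxF p])%fset &
      forall p, M ([fset p], [fset BoxP p])%fset].

Definition GRZT_R : set (rule tform) :=
  smallest tense_rule_system [set @theorem_rule tform p | p in GRZT].

Definition NExt_R (X : set (rule tform)) : set (set (rule tform)) :=
  [set M | tense_rule_system M /\ X `<=` M].

Definition Ext_biIPC : set (set bform) := [set L | bsi_logic L].
Definition Ext_biIPC_R : set (set (rule bform)) := [set L | bsi_rule_system L].

Fixpoint Tr (p : bform) : tform :=
  match p with
  | BVar n => BoxF (TVar n)
  | BBot => TBot
  | BTop => TTop
  | BAnd p q => TAnd (Tr p) (Tr q)
  | BOr p q => TOr (Tr p) (Tr q)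
  | Imp p q => BoxF (TOr (Not (Tr p)) (Tr q))
  | Coimp p q => DiaP (TAnd (Tr p) (Not (Tr q)))
  end.

Definition Tr_rule : rule bform -> rule tform := map_rule Tr.

Definition sigma_R (L : set (rule bform)) : set (rule tform) :=
  oplus tense_rule_system GRZT_R (Tr_rule @` L).

Definition rho_R (M : set (rule tform)) : set (rule bform) := Tr_rule @^-1` M.

Definition sigma (L : set bform) : set tform :=
  oplus tense_logic GRZT (Tr @` L).

Definition rho (M : set tform) : set bform := Tr @^-1` M.

(* The four carriers are closed under arbitrary intersections, hence complete
   lattices whose joins are those given by [join]. *)
Definition meet_closed (U : Type) (C : set (set U)) : Prop :=
  forall F : set (set U), F `<=` C -> C (meet F).

Lemma join_lub (U : Type) (C : set (set U)) (F : set (set U)) :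
  meet_closed C ->
  [/\ C (join C F), forall L, F L -> L `<=` join C F &
      forall M, C M -> (forall L, F L -> L `<=` M) -> join C F `<=` M].
Proof.
move=> meetC; split=> [|L FL p Lp|M CM ubM].
- by apply: meetC => L [].
- by apply: sub_gen_smallest; exists L.
- by apply: smallest_sub => // p [L FL Lp]; apply: (ubM L FL).
Qed.

Lemma bsi_closed_meet : meet_closed bsi_closed.
Proof.
move=> F FC; split=> [s p Fp L FL|p q Fp Fpq L FL|p Fp L FL];
  have [sub mp dn] := FC L FL.
- exact: sub (Fp L FL).
- exact: mp (Fp L FL) (Fpq L FL).
- exact: dn (Fp L FL).
Qed.

Lemma tense_closed_meet : meet_closed tense_closed.
Proof.
move=> F FC; split=> [s p Fp L FL|p q Fp Fpq L FL|p Fp L FL|p Fp L FL];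
  have [sub mp nF nP] := FC L FL.
- exact: sub (Fp L FL).
- exact: mp (Fp L FL) (Fpq L FL).
- exact: nF (Fp L FL).
- exact: nP (Fp L FL).
Qed.

Lemma rule_system_meet (A : choiceType) (sub : (nat -> A) -> A -> A) :
  meet_closed (rule_system sub).
Proof.
move=> F FC; split=> [s r Fr L FL|p L FL|G D G' D' Fr L FL|G D p F1 F2 L FL];
  have [sb rf wk cut] := FC L FL.
- exact: sb (Fr L FL).
- exact: rf.
- exact: wk (Fr L FL).
- exact: cut (F1 L FL) (F2 L FL).
Qed.

Lemma Ext_biIPC_meet : meet_closed Ext_biIPC.
Proof.
move=> F FC; split; first by apply: bsi_closed_meet => L /FC[].
by move=> p bp L /FC[_]; apply.
Qed.

Lemma NExt_meet (X : set tform) : meet_closed (NExt X).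
Proof.
move=> F FC; split; last by move=> p Xp L /FC[_]; apply.
split; first by apply: tense_closed_meet => L /FC[[]].
by move=> p Sp L /FC[[_ S4L] _]; apply: S4L.
Qed.

Lemma Ext_biIPC_R_meet : meet_closed Ext_biIPC_R.
Proof.
move=> F FC; split.
- by apply: rule_system_meet => L /FC[].
- by move=> r br L /FC[_ + _ _]; apply.
- by move=> p q L /FC[].
- by move=> p L /FC[].
Qed.

Lemma NExt_R_meet (X : set (rule tform)) : meet_closed (NExt_R X).
Proof.
move=> F FC; split; last by move=> p Xp L /FC[_]; apply.
split.
- by apply: rule_system_meet => L /FC[[]].
- by move=> r Sr L /FC[[_ + _ _ _] _]; apply.
- by move=> p q L /FC[[]].
- by move=> p L /FC[[]].
- by move=> p L /FC[[]].
Qed.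

(* Main.v *)
Require Import Defs.

(** Everything is computed in canonical Kripke models, that is, in preorders.

    [rho (sigma L) = L]: in the canonical model of bi-IPC the Boolean combinations
    of definable up-sets form a tense algebra whose interior operator takes values
    in definable up-sets. It validates both Grzegorczyk axioms, because a Boolean
    combination of finitely many up-sets changes its value only finitely often along
    the order. Reading rules of [L] in it gives a tense rule system that contains
    [sigma L] but no translation of a rule outside [L].

    [sigma (rho M) = M]: each formula is interderivable over GRZ.T with an instance
    of a translation. Fix a finite set of formulae closed under subformulae, so that
    every world has a finite type. The Grzegorczyk axioms put above and below every
    world a world of the same type that is settled: moving on from it, the type is
    never left and met again. Being settled with type [j] is expressed by up-sets,
    hence so is a modified type that agrees with the actual one on modal formulae and
    at settled worlds. Substituting for each variable the combination of boxed
    formulae that says that the modified type contains it changes no boxed formula of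
    the set.

    The statement for logics follows from the one for rule systems by passing to the
    admissible rules of a logic, except for [sigma (rho M) = M], where the same
    reduction applies directly. *)

Set Implicit Arguments.
Unset Strict Implicit.
Unset Printing Implicit Defensive.

Local Open Scope classical_set_scope.

(** Monotone mutual inverses form an order isomorphism, and meets and joins are determined by the
    order alone, since both carriers are closed under intersections. *)
Lemma complete_lattice_isomorphism_inverses (U V : Type) (C : set (set U))
    (D : set (set V)) (f : set U -> set V) (g : set V -> set U) :
  meet_closed C -> meet_closed D ->
  (forall L, C L -> D (f L)) -> (forall M, D M -> C (g M)) ->
  {homo f : L L' / L `<=` L'} -> {homo g : M M' / M `<=` M'} ->
  (forall L, C L -> g (f L) = L) -> (forall M, D M -> f (g M) = M) ->
  complete_lattice_isomorphism C D f.
Proof.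
move=> mC mD fCD gDC fmono gmono gfK fgK; split.
- split=> [L /fCD //|L L' /set_mem CL /set_mem CL' eqf|M DM].
    by rewrite -(gfK _ CL) eqf gfK.
  by exists (g M); [apply: gDC|apply: fgK].
- move=> F FC; apply/seteqP; split.
    by move=> x fx _ [L FL <-]; apply: fmono fx => p; apply.
  have DM : D (meet (f @` F)) by apply: mD => _ [L FL <-]; apply/fCD/FC.
  rewrite -{1}(fgK _ DM); apply: fmono => p gp L FL.
  rewrite -(gfK _ (FC _ FL)); apply: gmono gp => q; apply; exact: imageP.
- move=> F FC; have fFD : f @` F `<=` D by move=> _ [L /FC CL <-]; apply: fCD.
  have [CJ ubJ lubJ] := join_lub F mC; have [DJ ubJ' lubJ'] := join_lub (f @` F) mD.
  apply/seteqP; split.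
    rewrite -(fgK _ DJ); apply: fmono; apply: lubJ => [|L FL]; first exact: gDC.
    by rewrite -(gfK _ (FC _ FL)); apply: gmono; apply: ubJ'; apply: imageP.
  apply: lubJ' => [|_ [L FL <-]]; first exact: fCD.
  by apply: fmono; apply: ubJ.
Qed.

(** * Extending a pair of theories to a partition *)

(** The negation says that the pair [X], [Y] is consistent. *)
Definition entails_inside (A : eqType) (ent : seq A -> seq A -> Prop)
    (X Y : set A) : Prop :=
  exists G D, [/\ {in G, forall x, X x}, {in D, forall y, Y y} & ent G D].

Section Lindenbaum.
Variables (A : eqType) (ent : seq A -> seq A -> Prop).
Hypothesis ent_refl : forall a, ent [:: a] [:: a].
Hypothesis ent_weaken : forall G G' D D',
  {subset G <= G'} -> {subset D <= D'} -> ent G D -> ent G' D'.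
Hypothesis ent_cut : forall a G D, ent G (a :: D) -> ent (a :: G) D -> ent G D.

(** Zorn's lemma gives a maximal extension [P] of [X] consistent with [Y]. Each formula outside [P]
    then entails, together with [P], part of [Y], so cuts remove the conclusions outside [P] one at
    a time. *)
Lemma lindenbaum (X Y : set A) : ~ entails_inside ent X Y ->
  exists P, [/\ X `<=` P, Y `<=` ~` P & ~ entails_inside ent P (~` P)].
Proof.
move=> conXY; pose con (Z : set A) := ~ entails_inside ent (X `|` Z) Y.
have [|Z [conZ maxZ]] := @Zorn_bigcup _ con.
  move=> F Fcon Ftot [G [D [GX DY GD]]].
  (* The finitely many premises lie in [X] or use a single member of the chain; the first case also
     covers the empty chain. *)
  have [sGX|[Z FZ sGZ]] : {in G, forall x, X x} \/
      exists2 Z, F Z & {in G, forall x, (X `|` Z) x}.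
  - move: GX {GD}; elim: G => [|x G IH] GX; first by left.
    have xin := GX _ (mem_head x G).
    have {}IH := IH (fun y yG => GX y (mem_behead (s := x :: G) yG)).
    have grow Z : F Z -> (X `|` Z) x -> {in G, forall y, (X `|` Z) y} ->
        exists2 Z, F Z & {in x :: G, forall y, (X `|` Z) y}.
      by move=> FZ Zx ZG; exists Z => // y; rewrite inE => /predU1P[->|/ZG].
    case: xin => [Xx|[Z1 FZ1 Zx]]; case: IH => [sG|[Z2 FZ2 sG]].
    + by left=> y; rewrite inE => /predU1P[->|/sG].
    + by right; apply: (grow Z2) => //; left.
    + by right; apply: (grow Z1) => //; [right|move=> y /sG; left].
    + right; case: (Ftot _ _ FZ1 FZ2) => sZ.
        by apply: (grow Z2) => //; right; apply: sZ.
      apply: (grow Z1) => //; first by right.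
      by move=> y /sG[|/sZ]; [left|right].
  - by apply: conXY; exists G, D.
  - by apply: (Fcon _ FZ); exists G, D.
pose P := X `|` Z.
have addP a : ~ P a -> exists G D,
    [/\ {in G, forall x, P x}, {in D, forall y, Y y} & ent (a :: G) D].
  move=> nPa; have /contrapT[G [D [GP DY GD]]] : ~ con (Z `|` [set a]).
    apply: maxZ; split; first by move=> x; left.
    by move=> /(_ a (or_intror erefl)) Za; apply: nPa; right.
  exists [seq x <- G | x != a], D; split=> // [x|].
    rewrite mem_filter => /andP[/eqP xa /GP[|[|]]]; [by left|by right|by []].
  apply: ent_weaken GD => // x xG; rewrite inE mem_filter.
  by case: (eqVneq x a).
have Pcon : ~ entails_inside ent P Y by exact: conZ.
have disjPY : Y `<=` ~` P.
  move=> y Yy Py; apply: Pcon; exists [:: y], [:: y].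
  by split; [move=> x /[1!inE] /eqP->|move=> x /[1!inE] /eqP->|exact: ent_refl].
exists P; split=> //; first by move=> x; left.
(* [E] collects the conclusions from [Y] brought in by the cuts already made. *)
suff noent D E G : {in G, forall x, P x} -> {in D, forall x, ~ P x} ->
    {in E, forall y, Y y} -> ~ ent G (D ++ E).
  by move=> [G [D [GP DP GD]]]; apply: (noent D [::] G) => //; rewrite cats0.
elim: D E G => [|d D IH] E G GP DP EY GDE; first by apply: Pcon; exists G, E.
have [G2 [E2 [G2P E2Y dGE]]] := addP d (DP _ (mem_head d D)).
apply: (IH (E ++ E2) (G ++ G2)).
- by move=> x; rewrite mem_cat => /orP[/GP|/G2P].
- by move=> x xD; apply: DP; rewrite inE xD orbT.
- by move=> x; rewrite mem_cat => /orP[/EY|/E2Y].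
apply: (ent_cut (a := d)).
  apply: ent_weaken GDE => x; rewrite !(inE, mem_cat); first by move->.
  by rewrite -?orbA; case/or3P => ->; rewrite ?orbT.
apply: ent_weaken dGE => x; rewrite !(inE, mem_cat).
  by case/orP => ->; rewrite ?orbT.
by move->; rewrite !orbT.
Qed.
End Lindenbaum.

(** * Kripke semantics of bi-intuitionistic logic *)

Definition preorder_on (W : Type) (R : W -> W -> Prop) : Prop :=
  (forall w, R w w) /\ (forall w u v, R w u -> R u v -> R w v).

Fixpoint bval (W : Type) (R : W -> W -> Prop) (v : nat -> W -> Prop)
    (p : bform) (w : W) : Prop :=
  match p with
  | BVar n => v n w
  | BBot => False
  | BTop => True
  | BAnd p q => bval R v p w /\ bval R v q w
  | BOr p q => bval R v p w \/ bval R v q w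
  | Imp p q => forall u, R w u -> bval R v p u -> bval R v q u
  | Coimp p q => exists u, [/\ R u w, bval R v p u & ~ bval R v q u]
  end.

Definition persistent (W : Type) (R : W -> W -> Prop) (U : W -> Prop) : Prop :=
  forall w u, R w u -> U w -> U u.

Section BiSoundness.
Variables (W : Type) (R : W -> W -> Prop).
Hypothesis preR : preorder_on R.
Let Rxx := preR.1.
Let Rtr := preR.2.

Lemma bval_persistent v p : (forall n, persistent R (v n)) ->
  persistent R (bval R v p).
Proof.
move=> pv; elim: p => //= [p IHp q IHq|p IHp q IHq|p _ q _|p _ q _] w u wu.
- by case=> /(IHp _ _ wu) ? /(IHq _ _ wu).
- by case=> [/(IHp _ _ wu)|/(IHq _ _ wu)]; [left|right].
- by move=> pq x ux; apply: pq; apply: Rtr ux.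
- by case=> x [xw px nqx]; exists x; split=> //; apply: Rtr wu.
Qed.

Lemma bval_subst v s p w :
  bval R v (bsubst s p) w <-> bval R (fun n => bval R v (s n)) p w.
Proof.
elim: p w => //= [p IHp q IHq|p IHp q IHq|p IHp q IHq|p IHp q IHq] w.
- by rewrite IHp IHq.
- by rewrite IHp IHq.
- by split=> pq u wu /IHp /(pq _ wu) /IHq.
- by split=> -[u [uw /IHp pu nqu]]; exists u; split=> // /IHq.
Qed.

Lemma bval_sound v p w : (forall n, persistent R (v n)) -> biIPC p ->
  bval R v p w.
Proof.
(* All persistent valuations are treated at once, since closure under substitution changes the
   valuation. *)
move=> pv; suff: biIPC `<=`
    [set p | forall v, (forall n, persistent R (v n)) -> forall w, bval R v p w].
  by move=> sub /sub; apply.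
apply: smallest_sub; first split.
- move=> s q qt v' pv' x; apply/bval_subst/qt => n.
  exact: bval_persistent.
- by move=> q r qt qrt v' pv' x; apply: qrt => //; apply: qt.
- by move=> q qt v' pv' x y _ [z [_ _]]; apply; apply: qt.
move=> _ [] /=.
- by move=> q r v' pv' x y _ qy z yz _; apply: bval_persistent yz qy.
- move=> q r s v' pv' x y _ qrs z yz qr t zt qt.
  by apply: (qrs t (Rtr yz zt) qt t (Rxx t)); apply: qr.
- by move=> q r v' pv' x y _ [].
- by move=> q r v' pv' x y _ [].
- move=> q r v' pv' x y _ qy z yz rz; split=> //; exact: bval_persistent yz qy.
- by move=> q r v' pv' x y _ qy; left.
- by move=> q r v' pv' x y _ qy; right.
- move=> q r s v' pv' x y _ qs z yz rs t zt [qt|rt]; last exact: rs.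
  by apply: qs qt; apply: Rtr zt.
- by [].
- by [].
- move=> q r v' pv' x y _ qy; case: (pselect (bval R v' r y)) => ry; first by left.
  by right; exists y.
- move=> q r v' pv' x y _ [z [zy qz nrz]]; exists z; split=> // qr.
  by apply: nrz; apply: qr.
- move=> q r s v' pv' x y _ [z [zy [t [tz qt nrt]] nsz]].
  exists t; split=> //; first exact: Rtr zy.
  by case=> // st; apply: nsz; apply: bval_persistent tz st.
- move=> q r v' pv' x y _ nqr z yz qz; apply: contrapT => nrz.
  by apply: (nqr z yz); exists z.
Qed.
End BiSoundness.

(** * Canonical model of bi-intuitionistic logic *)

Lemma biIPC_closed : bsi_closed biIPC.
Proof.
split=> [s p bp|p q bp bpq|p bp] L LC; have [[sub mp dn] _] := LC.
- exact: sub (bp L LC).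
- exact: mp (bp L LC) (bpq L LC).
- exact: dn (bp L LC).
Qed.

Lemma biIPC_ax p : biIPC_axiom p -> biIPC p.
Proof. by move=> ax L [_]; apply. Qed.

Lemma biIPC_mp p q : biIPC p -> biIPC (Imp p q) -> biIPC q.
Proof. by case: biIPC_closed => _ mp _; apply: mp. Qed.

(* [bder [:: a1; ...; an] p] says that [an -> ... -> a1 -> p] is a theorem, which
   makes the deduction theorem hold by conversion. *)
Fixpoint bder (G : seq bform) (p : bform) : Prop :=
  if G is a :: G' then bder G' (Imp a p) else biIPC p.

Lemma bder_theorem G p : biIPC p -> bder G p.
Proof.
by elim: G p => //= a G IH p bp; apply: IH; apply: biIPC_mp bp (biIPC_ax (BAxK _ _)).
Qed.

Lemma bder_mp G p q : bder G p -> bder G (Imp p q) -> bder G q.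
Proof.
elim: G p q => /= [p q|a G IH p q ap apq]; first exact: biIPC_mp.
by apply: (IH _ _ ap); apply: (IH _ _ apq); exact: bder_theorem (biIPC_ax (BAxS _ _ _)).
Qed.

Lemma bder_ax G p : biIPC_axiom p -> bder G p.
Proof. by move=> /biIPC_ax; apply: bder_theorem. Qed.

Lemma bder_hyp G p : p \in G -> bder G p.
Proof.
elim: G p => //= a G IH p; rewrite inE => /predU1P[->|/IH pG].
  apply: bder_mp (bder_ax _ (BAxK a a)) _.
  by apply: bder_mp (bder_ax _ (BAxK a (Imp a a))) (bder_ax _ (BAxS _ _ _)).
exact: bder_mp pG (bder_ax _ (BAxK _ _)).
Qed.

Lemma bder_axE G p q : biIPC_axiom (Imp p q) -> bder G p -> bder G q.
Proof. by move=> /(bder_ax G) pq Gp; apply: bder_mp Gp pq. Qed.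

Lemma bder_cut G G' p : {in G, forall a, bder G' a} -> bder G p -> bder G' p.
Proof.
elim: G p => [|a G IH] p GG' /=; first exact: bder_theorem.
move=> Gap; apply: (bder_mp (GG' _ (mem_head a G))).
by apply: IH Gap => b bG; apply: GG'; rewrite inE bG orbT.
Qed.

Lemma bder_sub G G' p : {subset G <= G'} -> bder G p -> bder G' p.
Proof. by move=> sG; apply: bder_cut => a /sG; apply: bder_hyp. Qed.

Lemma bder_orE G p q r : bder G (BOr p q) -> bder (p :: G) r -> bder (q :: G) r ->
  bder G r.
Proof.
move=> pq pr qr; apply: (bder_mp pq); apply: (bder_mp (qr : bder G (Imp q r))).
exact: bder_mp (pr : bder G (Imp p r)) (bder_ax _ (BAxOrE _ _ _)).
Qed.

Definition bigor : seq bform -> bform := foldr BOr BBot.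

Lemma bder_bigorI G D p : p \in D -> bder G p -> bder G (bigor D).
Proof.
elim: D => //= a D IH; rewrite inE => /predU1P[->|pD] Gp.
  exact: bder_axE (BAxOrI1 _ _) Gp.
exact: bder_axE (BAxOrI2 _ _) (IH pD Gp).
Qed.

Lemma bder_bigorE G D p : bder G (bigor D) -> {in D, forall a, bder (a :: G) p} ->
  bder G p.
Proof.
elim: D G => [|a D IH] G /= GD Dp.
  exact: bder_axE (BAxBot _) GD.
apply: bder_orE GD _ _; first exact/Dp/mem_head.
apply: IH; first exact/bder_hyp/mem_head.
move=> b bD; apply: (@bder_sub (b :: G)).
  by move=> x; rewrite !inE => /orP[]->; rewrite ?orbT.
by apply: Dp; rewrite inE bD orbT.
Qed.

Definition bent (G D : seq bform) : Prop := bder G (bigor D).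

Lemma bent_refl a : bent [:: a] [:: a].
Proof. by apply: bder_bigorI (mem_head _ _) _; apply/bder_hyp/mem_head. Qed.

Lemma bent_weaken G G' D D' : {subset G <= G'} -> {subset D <= D'} ->
  bent G D -> bent G' D'.
Proof.
move=> sG sD /(bder_sub sG) GD; apply: bder_bigorE GD _ => a aD.
by apply: bder_bigorI (sD _ aD) _; apply/bder_hyp/mem_head.
Qed.

Lemma bent_cut a G D : bent G (a :: D) -> bent (a :: G) D -> bent G D.
Proof. by move=> GaD aGD; apply: bder_orE GaD aGD _; apply/bder_hyp/mem_head. Qed.

(** With conclusions read disjunctively, this is closure under derivability, consistency and
    primeness in one condition. *)
Definition prime_theory (P : set bform) : Prop := ~ entails_inside bent P (~` P).

Definition bcanon : Type := {P : set bform | prime_theory P}.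
Definition bcanon_rel (P Q : bcanon) : Prop := sval P `<=` sval Q.
Definition bcanon_val (n : nat) (P : bcanon) : Prop := sval P (BVar n).

Lemma bcanon_preorder : preorder_on bcanon_rel.
Proof. by split=> [P|P Q S PQ QS] p // /PQ /QS. Qed.

Lemma bcanon_val_persistent n : persistent bcanon_rel (bcanon_val n).
Proof. by move=> P Q PQ /PQ. Qed.

Lemma bcanon_extend (X Y : set bform) : ~ entails_inside bent X Y ->
  exists P : bcanon, X `<=` sval P /\ Y `<=` ~` sval P.
Proof.
move=> /(lindenbaum bent_refl bent_weaken bent_cut)[P [XP YP prP]].
by exists (exist _ P prP).
Qed.

Section PrimeTheory.
Variable P : bcanon.

Lemma prime_der G p : {in G, forall a, sval P a} -> bder G p -> sval P p.
Proof.
move=> GP Gp; apply: contrapT => nPp; apply: (svalP P); exists G, [:: p]; split=> //.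
  by move=> x /[1!inE] /eqP->.
exact: bder_bigorI (mem_head _ _) Gp.
Qed.

Lemma prime_mp p q : sval P p -> sval P (Imp p q) -> sval P q.
Proof.
move=> Pp Ppq; apply: (@prime_der [:: p; Imp p q]).
  by move=> x; rewrite !inE => /orP[]/eqP->.
by apply: (@bder_mp _ p); apply: bder_hyp; rewrite !inE eqxx ?orbT.
Qed.

Lemma prime_ax p q : biIPC_axiom (Imp p q) -> sval P p -> sval P q.
Proof. by move=> ax Pp; apply: (prime_mp Pp); apply: (@prime_der [::]) (biIPC_ax ax). Qed.

Lemma prime_bot : ~ sval P BBot.
Proof.
move=> Pb; apply: (svalP P); exists [:: BBot], [::]; split=> //.
  by move=> x /[1!inE] /eqP->.
exact/bder_hyp/mem_head.
Qed.

Lemma prime_or p q : sval P (BOr p q) -> sval P p \/ sval P q.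
Proof.
move=> Pb; apply: contrapT => /not_orP[nPp nPq]; apply: (svalP P).
exists [:: BOr p q], [:: p; q]; split=> [x /[1!inE] /eqP->//|x|].
  by rewrite !inE => /orP[]/eqP->.
apply: bder_orE (bder_hyp (mem_head _ _)) _ _.
  by apply: (@bder_bigorI _ _ p); rewrite ?inE ?eqxx //; apply/bder_hyp/mem_head.
apply: (@bder_bigorI _ _ q); rewrite ?inE ?eqxx ?orbT //; exact/bder_hyp/mem_head.
Qed.

(** If [P] and [p] derived [q], the deduction theorem would put the implication into [P]. *)
Lemma prime_imp p q : ~ sval P (Imp p q) ->
  exists Q, [/\ bcanon_rel P Q, sval Q p & ~ sval Q q].
Proof.
move=> nPpq; have [|Q [PQ nQ]] := @bcanon_extend (sval P `|` [set p]) [set q].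
  move=> [G [D [GP Dq GD]]]; apply: nPpq.
  apply: (@prime_der [seq x <- G | x != p]).
    move=> x; rewrite mem_filter => /andP[/eqP xp /GP[//|]]; by [].
  apply: (@bder_bigorE (p :: [seq x <- G | x != p]) D).
    apply: bder_sub GD => x xG; rewrite inE mem_filter xG andbT.
    by case: eqP.
  by move=> x /Dq ->; apply/bder_hyp/mem_head.
exists Q; split; [by move=> r Pr; apply: PQ; left|by apply: PQ; right|exact: nQ].
Qed.

(** The half of the adjunction that rests on the rule for coimplication. Applied to the hypothesis,
    the rule refutes [Coimp BTop (Imp p (BOr q r))], which follows from [Coimp (Coimp p q) r]; a
    refuted coimplication yields the implication. *)
Lemma biIPC_coimp p q r : biIPC (Imp p (BOr q r)) -> biIPC (Imp (Coimp p q) r).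
Proof.
have [_ _ dn] := biIPC_closed; move=> /dn bneg_pqr.
apply: biIPC_mp (biIPC_ax (BAxCoimpNeg _ _)).
suff: bder [:: Coimp (Coimp p q) r] BBot by [].
apply: bder_mp (bder_theorem _ bneg_pqr).
apply: bder_axE (BAxCoimpImp _ _) _; apply: bder_axE (BAxCoimpOr _ _ _) _.
exact/bder_hyp/mem_head.
Qed.

(** [Q] must contain [p] and avoid [q] and everything outside [P]. If [p] entailed [q] joined with a
    disjunction of formulae outside [P], the adjunction would bring that disjunction into [P]. *)
Lemma prime_coimp p q : sval P (Coimp p q) ->
  exists Q, [/\ bcanon_rel Q P, sval Q p & ~ sval Q q].
Proof.
move=> Ppq; have [|Q [pQ nQ]] := @bcanon_extend [set p] (~` sval P `|` [set q]).
  move=> [G [D [Gp DP GD]]]; set D' := [seq x <- D | x != q].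
  suff: sval P (bigor D').
    move=> PD'; apply: (svalP P); exists [:: bigor D'], D'.
    split; [by move=> x /[1!inE] /eqP->| |exact/bder_hyp/mem_head].
    by move=> x; rewrite mem_filter => /andP[/eqP xq /DP[//|]].
  apply: (prime_mp Ppq); apply: (@prime_der [::]) => //; apply: biIPC_coimp.
  suff: bder [:: p] (bigor (q :: D')) by [].
  apply: (@bder_cut G) => [x /Gp ->|]; first exact/bder_hyp/mem_head.
  apply: bent_weaken GD => // x xD; rewrite inE mem_filter xD andbT.
  by case: eqP.
exists Q; split; [move=> r Qr|exact: pQ|by apply: nQ; right].
by apply: contrapT => nPr; apply: nQ Qr; left.
Qed.
End PrimeTheory.

Lemma bcanon_truth p P : bval bcanon_rel bcanon_val p P <-> sval P p.
Proof.
elim: p P => //= [||p IHp q IHq|p IHp q IHq|p IHp q IHq|p IHp q IHq] P.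
- by split=> // /prime_bot.
(* [BTop] is not itself an axiom; it follows from any theorem by [BAxTop]. *)
- split=> // _; apply: (@prime_der P [:: Imp BBot BBot]) => [x|].
    rewrite inE => /eqP->; apply: (@prime_der P [::]) => //; exact: biIPC_ax (BAxBot _).
  exact: bder_axE (BAxTop (Imp BBot BBot)) (bder_hyp (mem_head _ _)).
- rewrite IHp IHq; split=> [[Pp Pq]|Ppq]; last first.
    by split; apply: prime_ax Ppq; constructor.
  by apply: (prime_mp Pq); apply: prime_ax Pp; constructor.
- rewrite IHp IHq; split=> [[Pp|Pq]|/prime_or//].
    by apply: prime_ax Pp; constructor.
  by apply: prime_ax Pq; constructor.
- split=> [pq|Ppq Q PQ /IHp Qp]; last by apply/IHq/(prime_mp Qp)/PQ.
  apply: contrapT => /prime_imp[Q [PQ /IHp Qp]]; apply.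
  by apply/IHq/pq.
- split=> [[Q [QP /IHp Qp nQq]]|/prime_coimp[Q [QP Qp nQq]]].
    have /prime_or[/IHq//|/QP//] : sval Q (BOr q (Coimp p q)).
    by apply: prime_ax Qp; constructor.
  by exists Q; split=> //; [apply/IHp|move/IHq].
Qed.

Lemma biIPC_complete p :
  biIPC p <-> forall P, bval bcanon_rel bcanon_val p P.
Proof.
split=> [bp P|valp].
  by apply: (bval_sound bcanon_preorder) bp; apply: bcanon_val_persistent.
apply: contrapT => nbp; have [|P [_ nP]] := @bcanon_extend set0 [set p].
  move=> [[|x G] [D [G0 Dp GD]]]; last by have := G0 _ (mem_head _ _).
  apply: nbp; apply: (@bder_bigorE [::] D p GD) => x /Dp ->; exact/bder_hyp/mem_head.
by apply: (nP p) => //; apply/bcanon_truth.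
Qed.

(** * Kripke semantics of tense logics *)

Fixpoint tval (W : Type) (R : W -> W -> Prop) (V : nat -> W -> Prop)
    (p : tform) (w : W) : Prop :=
  match p with
  | TVar n => V n w
  | TBot => False
  | TTop => True
  | TAnd p q => tval R V p w /\ tval R V q w
  | TOr p q => tval R V p w \/ tval R V q w
  | Not p => ~ tval R V p w
  | BoxF p => forall u, R w u -> tval R V p u
  | DiaP p => exists2 u, R u w & tval R V p u
  end.

Section TenseSemantics.
Variables (W : Type) (R : W -> W -> Prop).
Hypothesis preR : preorder_on R.
Let Rxx := preR.1.
Let Rtr := preR.2.

Lemma tval_subst V s p w :
  tval R V (tsubst s p) w <-> tval R (fun n => tval R V (s n)) p w.
Proof.
elim: p w => //= [p IHp q IHq|p IHp q IHq|p IHp|p IHp|p IHp] w.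
- by rewrite IHp IHq.
- by rewrite IHp IHq.
- by rewrite IHp.
- by split=> Hp u /Hp /IHp.
- by split=> -[u uw /IHp]; exists u.
Qed.

Lemma tval_Tr V p w :
  tval R V (Tr p) w <-> bval R (fun n w => forall u, R w u -> V n u) p w.
Proof.
elim: p w => //= [p IHp q IHq|p IHp q IHq|p IHp q IHq|p IHp q IHq] w.
- by rewrite IHp IHq.
- by rewrite IHp IHq.
- split=> pq u wu; last first.
    case: (pselect (tval R V (Tr p) u)) => [/IHp pu|]; last by left.
    by right; apply/IHq/pq.
  by move=> /IHp pu; apply/IHq; case: (pq u wu).
- split=> [[u uw [/IHp pu nq]]|[u [uw /IHp pu nq]]].
    by exists u; split=> // /IHq.
  by exists u => //; split=> // /IHq.
Qed.

Lemma boxF_persistent (U : W -> Prop) : persistent R (fun w => forall u, R w u -> U u).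
Proof. by move=> w u wu Uw x ux; apply: Uw; apply: Rtr ux. Qed.

Lemma tval_BoxP V p w :
  tval R V (BoxP p) w <-> (forall u, R u w -> tval R V p u).
Proof.
split=> [nex u uw|all [u uw] nep]; last exact/nep/all.
by apply: contrapT => np; apply: nex; exists u.
Qed.

Lemma tval_DiaF V p w :
  tval R V (DiaF p) w <-> (exists2 u, R w u & tval R V p u).
Proof.
split=> [nall|[u wu pu] all]; last exact: all pu.
by apply: contrapT => nex; apply: nall => u wu pu; apply: nex; exists u.
Qed.

Lemma tval_timp V p q w :
  tval R V (timp p q) w <-> (tval R V p w -> tval R V q w).
Proof.
split=> [[]//|pq]; case: (pselect (tval R V p w)) => [/pq|]; by [right|left].
Qed.

Lemma tval_tiff V p q w :
  tval R V (tiff p q) w <-> (tval R V p w <-> tval R V q w).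
Proof.
by split=> [[/tval_timp pq /tval_timp qp]|[pq qp]]; split=> //; apply/tval_timp.
Qed.

Lemma tval_teval V p w : tval R V p w <-> teval (fun q => `[< tval R V q w >]) p.
Proof.
elim: p => [n|||p IHp q IHq|p IHp q IHq|p IHp|p IHp|p IHp] /=.
- exact: rwP (asboolP _).
- by [].
- by [].
- by rewrite IHp IHq; exact: rwP andP.
- by rewrite IHp IHq; exact: rwP orP.
- by split=> [np|/negP np]; [apply/negP => /IHp|move=> /IHp].
- exact: rwP (asboolP _).
- exact: rwP (asboolP _).
Qed.

Lemma Kt_axiom_sound V p w : Kt_axiom p -> tval R V p w.
Proof.
case=> {}p.
- by move=> tautp; apply/tval_teval/tautp.
- move=> q; apply/tval_timp => pq; apply/tval_timp => pw u wu.
  by move: (pq u wu) => /tval_timp; apply; apply: pw.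
- move=> q; apply/tval_timp => /tval_BoxP pq.
  apply/tval_timp => /tval_BoxP pw; apply/tval_BoxP => u wu.
  by move: (pq u wu) => /tval_timp; apply; apply: pw.
- apply/tval_tiff; split=> [[u uw pu]|nall].
    by apply; exists u => //; apply.
  by apply: contrapT => nex; apply: nall => -[u uw nnpu]; apply: nnpu => pu; apply: nex; exists u.
- by apply/tval_timp => pw u wu; exists w.
- by apply/tval_timp => pw; apply/tval_BoxP => u uw; apply/tval_DiaF; exists w.
Qed.

Lemma S4_axiom_sound V p w : S4_axiom p -> tval R V p w.
Proof.
case=> {}p; apply/tval_timp.
- by apply; apply: Rxx.
- by move=> pw u wu x ux; apply: pw; apply: Rtr ux.
- by move=> /tval_BoxP; apply; apply: Rxx.
- move=> /tval_BoxP pw; apply/tval_BoxP => u uw; apply/tval_BoxP => x xu.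
  by apply: pw; apply: Rtr uw.
Qed.

Lemma S4t_sound V p w : S4t p -> tval R V p w.
Proof.
suff: S4t `<=` [set p | forall V w, tval R V p w] by move=> sub /sub; apply.
apply: smallest_sub => [|q ax V' x]; last exact: S4_axiom_sound.
split; last by move=> q ax V' x; apply: Kt_axiom_sound.
split=> [s q qt V' x|q r qt qrt V' x|q qt V' x u _|q qt V' x].
- by apply/tval_subst.
- by move: (qrt V' x) => /tval_timp; apply.
- exact: qt.
- by apply/tval_BoxP => u _; apply: qt.
Qed.
End TenseSemantics.

Lemma S4t_normal : normal_tense_logic S4t.
Proof.
split; last by move=> p ax L [[_ axL] _]; apply: axL.
split=> [s p Sp|p q Sp Spq|p Sp|p Sp] L LC; have [[[sub mp nF nP] _] _] := LC.
- exact: sub (Sp L LC).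
- exact: mp (Sp L LC) (Spq L LC).
- exact: nF (Sp L LC).
- exact: nP (Sp L LC).
Qed.

Lemma S4t_tense : tense_logic S4t.
Proof. by split=> //; case: S4t_normal. Qed.

(** * Canonical models of tense logics *)

Section TenseCanonical.
Variable M : set tform.
Hypothesis logicM : tense_logic M.

Let M_mp p q : M p -> M (timp p q) -> M q.
Proof. by case: logicM => -[_ mp _ _] _; apply: mp. Qed.

Let M_Kt p : Kt_axiom p -> M p.
Proof. by move=> ax; apply: logicM.2; apply: S4t_normal.2. Qed.

Let M_S4 p : S4_axiom p -> M p.
Proof. by move=> ax; apply: logicM.2 => L [_]; apply. Qed.

Lemma tense_taut1 p q : (forall v, teval v p -> teval v q) -> M p -> M q.
Proof.
move=> pq Mp; apply: (M_mp Mp); apply: M_Kt; apply: KtTaut => v /=.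
by rewrite -implybE; apply/implyP/pq.
Qed.

Lemma tense_taut2 p q r : (forall v, teval v p -> teval v q -> teval v r) ->
  M p -> M q -> M r.
Proof.
move=> pqr Mp Mq; apply: (M_mp Mq); apply: tense_taut1 Mp => v pv /=.
by rewrite -implybE; apply/implyP/pqr.
Qed.

Lemma tense_taut p : (forall v, teval v p) -> M p.
Proof. by move=> ?; apply: M_Kt; apply: KtTaut. Qed.

Definition bigtand : seq tform -> tform := foldr TAnd TTop.
Definition bigtor : seq tform -> tform := foldr TOr TBot.

Lemma teval_bigtand v G : teval v (bigtand G) = all (teval v) G.
Proof. by elim: G => //= a G ->. Qed.

Lemma teval_bigtor v D : teval v (bigtor D) = has (teval v) D.
Proof. by elim: D => //= a D ->. Qed.

Definition tent (G D : seq tform) : Prop := M (timp (bigtand G) (bigtor D)).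

Let tentE v G D : teval v (timp (bigtand G) (bigtor D)) =
  (all (teval v) G ==> has (teval v) D).
Proof. by rewrite /= teval_bigtand teval_bigtor implybE. Qed.

Lemma tent_refl a : tent [:: a] [:: a].
Proof. by apply: tense_taut => v; rewrite tentE /= andbT orbF implybb. Qed.

Lemma tent_weaken G G' D D' : {subset G <= G'} -> {subset D <= D'} ->
  tent G D -> tent G' D'.
Proof.
move=> sG sD; apply: tense_taut1 => v; rewrite !tentE => /implyP GD.
apply/implyP => /allP G'v; have /hasP[a aD av] : has (teval v) D.
  by apply: GD; apply/allP => x /sG /G'v.
by apply/hasP; exists a => //; apply: sD.
Qed.

Lemma tent_cut a G D : tent G (a :: D) -> tent (a :: G) D -> tent G D.
Proof.
apply: tense_taut2 => v; rewrite !tentE /=.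
by case: (teval v a); case: (all _ G); case: (has _ D).
Qed.

(** Primeness for classical entailment; excluded middle makes such a set decide every formula. *)
Definition maximal_consistent (P : set tform) : Prop :=
  ~ entails_inside tent P (~` P).

Definition tcanon : Type := {P : set tform | maximal_consistent P}.
Definition tcanon_rel (P Q : tcanon) : Prop :=
  forall p, sval P (BoxF p) -> sval Q p.
Definition tcanon_val (n : nat) (P : tcanon) : Prop := sval P (TVar n).

Lemma tcanon_extend (X Y : set tform) : ~ entails_inside tent X Y ->
  exists P : tcanon, X `<=` sval P /\ Y `<=` ~` sval P.
Proof.
move=> /(lindenbaum tent_refl tent_weaken tent_cut)[P [XP YP maxP]].
by exists (exist _ P maxP).
Qed.

Lemma mcs_ent (P : tcanon) G D : {in G, forall a, sval P a} -> tent G D ->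
  exists2 a, a \in D & sval P a.
Proof.
move=> GP GD; apply: contrapT => nD; apply: (svalP P); exists G, D; split=> // a aD Pa.
by apply: nD; exists a.
Qed.

Section Mcs.
Variable P : tcanon.

Lemma mcs_imp p q : M (timp p q) -> sval P p -> sval P q.
Proof.
move=> Mpq Pp; have [||a] := @mcs_ent P [:: p] [:: q].
- by move=> x /[1!inE] /eqP->.
- by apply: tense_taut1 Mpq => v; rewrite tentE /= andbT orbF implybE.
- by rewrite inE => /eqP->.
Qed.

Lemma mcs_taut p q : (forall v, teval v p -> teval v q) -> sval P p -> sval P q.
Proof. by move=> pq; apply/mcs_imp/tense_taut => v /=; rewrite -implybE; apply/implyP/pq. Qed.

Lemma mcs_theorem p : M p -> sval P p.
Proof.
move=> Mp; have [||a] := @mcs_ent P [::] [:: p] => //.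
  by apply: tense_taut1 Mp => v; rewrite tentE /= orbF.
by rewrite inE => /eqP->.
Qed.

Lemma mcs_and p q : sval P (TAnd p q) <-> sval P p /\ sval P q.
Proof.
split=> [pq|[Pp Pq]].
  by split; apply: mcs_taut pq => v /= /andP[].
have [||a] := @mcs_ent P [:: p; q] [:: TAnd p q].
- by move=> x; rewrite !inE => /orP[]/eqP->.
- by apply: tense_taut => v; rewrite tentE /= andbT orbF implybb.
- by rewrite inE => /eqP->.
Qed.

Lemma mcs_or p q : sval P (TOr p q) <-> sval P p \/ sval P q.
Proof.
split=> [pq|[]]; [|by apply: mcs_taut => v /= ->|by apply: mcs_taut => v /= ->; rewrite orbT].
have [||a] := @mcs_ent P [:: TOr p q] [:: p; q].
- by move=> x /[1!inE] /eqP->.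
- by apply: tense_taut => v; rewrite tentE /= andbT orbF implybb.
- by rewrite !inE => /orP[]/eqP->; [left|right].
Qed.

Lemma mcs_bot : ~ sval P TBot.
Proof.
move=> Pb; have [||a //] := @mcs_ent P [:: TBot] [::].
  by move=> x /[1!inE] /eqP->.
by apply: tense_taut.
Qed.

Lemma mcs_not p : sval P (Not p) <-> ~ sval P p.
Proof.
split=> [Pn Pp|nPp].
  by apply: mcs_bot; apply: (@mcs_taut (TAnd p (Not p))) => [v /=|];
    [rewrite andbN|apply/mcs_and].
have /mcs_or[//|//] : sval P (TOr p (Not p)).
by apply/mcs_theorem/tense_taut => v /=; rewrite orbN.
Qed.

Lemma mcs_boxF_bigtand G : {in G, forall a, sval P (BoxF a)} -> sval P (BoxF (bigtand G)).
Proof.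
have [_ _ nF _] := logicM.1.
elim: G => [_|a G IH GP] /=; first by apply/mcs_theorem/nF/tense_taut.
have PG : sval P (BoxF (bigtand G)).
  by apply: IH => b bG; apply: GP; rewrite inE bG orbT.
have Pa := GP _ (mem_head a G).
have : sval P (BoxF (timp (bigtand G) (TAnd a (bigtand G)))).
  apply: mcs_imp Pa; apply: (M_mp _ (M_Kt (KtKF _ _))); apply/nF/tense_taut => v /=.
  by case: (teval v a); case: (teval v _).
move=> /(mcs_imp (M_Kt (KtKF _ _))) /mcs_or[/mcs_not//|//].
Qed.

Lemma mcs_boxP_bigtand G : {in G, forall a, sval P (BoxP a)} -> sval P (BoxP (bigtand G)).
Proof.
have [_ _ _ nP] := logicM.1.
elim: G => [_|a G IH GP] /=; first by apply/mcs_theorem/nP/tense_taut.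
have PG : sval P (BoxP (bigtand G)).
  by apply: IH => b bG; apply: GP; rewrite inE bG orbT.
have Pa := GP _ (mem_head a G).
have : sval P (BoxP (timp (bigtand G) (TAnd a (bigtand G)))).
  apply: mcs_imp Pa; apply: (M_mp _ (M_Kt (KtKP _ _))); apply/nP/tense_taut => v /=.
  by case: (teval v a); case: (teval v _).
move=> /(mcs_imp (M_Kt (KtKP _ _))) /mcs_or[/mcs_not//|//].
Qed.

Lemma mcs_boxF_mono p q : M (timp p q) -> sval P (BoxF p) -> sval P (BoxF q).
Proof.
have [_ _ nF _] := logicM.1.
by move=> /nF Mpq; apply: mcs_imp; apply: M_mp Mpq (M_Kt (KtKF _ _)).
Qed.

Lemma mcs_boxP_mono p q : M (timp p q) -> sval P (BoxP p) -> sval P (BoxP q).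
Proof.
have [_ _ _ nP] := logicM.1.
by move=> /nP Mpq; apply: mcs_imp; apply: M_mp Mpq (M_Kt (KtKP _ _)).
Qed.

Lemma mcs_diaP p : sval P (DiaP p) <-> ~ sval P (BoxP (Not p)).
Proof.
have Mdual := M_Kt (KtDual p); split=> [PDp|/(mcs_not _).2].
  apply: (mcs_not _).1; apply: mcs_imp PDp.
  by apply: tense_taut1 Mdual => v /= /andP[].
by apply: mcs_imp; apply: tense_taut1 Mdual => v /= /andP[].
Qed.

(** If the contents of the boxes in [P] entailed [p], normality would put [BoxF p] into [P]; so they
    extend to a maximal set without [p]. *)
Lemma mcs_boxF_ex p : ~ sval P (BoxF p) -> exists2 Q, tcanon_rel P Q & ~ sval Q p.
Proof.
move=> nPp.
have [|Q [PQ nQ]] := @tcanon_extend [set q | sval P (BoxF q)] [set p].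
  move=> [G [D [GP Dp GD]]]; apply: nPp.
  apply: mcs_boxF_mono (mcs_boxF_bigtand GP).
  apply: tense_taut1 GD => v /=; case: (teval v (bigtand G)) => //=.
  by rewrite teval_bigtor => /hasP[x /Dp ->].
by exists Q => //; apply: nQ.
Qed.

Lemma mcs_boxP_ex p : ~ sval P (BoxP p) ->
  exists2 Q : tcanon, (forall q, sval P (BoxP q) -> sval Q q) & ~ sval Q p.
Proof.
move=> nPp.
have [|Q [PQ nQ]] := @tcanon_extend [set q | sval P (BoxP q)] [set p].
  move=> [G [D [GP Dp GD]]]; apply: nPp.
  apply: mcs_boxP_mono (mcs_boxP_bigtand GP).
  apply: tense_taut1 GD => v /=; case: (teval v (bigtand G)) => //=.
  by rewrite teval_bigtor => /hasP[x /Dp ->].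
by exists Q => //; apply: nQ.
Qed.
End Mcs.

(** The axioms [KtFP] and [KtPF] let one relation serve both modalities: a formula missing from [P]
    has its negation there, so [BoxF (DiaP (Not p))] is in [P] and [Q] cannot contain [BoxP p]. The
    other direction is symmetric. *)
Lemma tcanon_rel_converse P Q :
  tcanon_rel P Q <-> (forall p, sval Q (BoxP p) -> sval P p).
Proof.
split=> rel p bp; apply: contrapT => /mcs_not np.
  have /rel/mcs_diaP : sval P (BoxF (DiaP (Not p))).
    exact: mcs_imp (M_Kt (KtFP _)) np.
  apply; apply: mcs_boxP_mono bp; apply: tense_taut => v /=.
  by case: (teval v p).
have /rel/mcs_not : sval Q (BoxP (DiaF (Not p))).
  exact: mcs_imp (M_Kt (KtPF _)) np.
apply; apply: mcs_boxF_mono bp; apply: tense_taut => v /=.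
by case: (teval v p).
Qed.

Lemma tcanon_preorder : preorder_on tcanon_rel.
Proof.
split=> [P p|P Q S PQ QS p]; first exact: mcs_imp (M_S4 (S4TF _)).
by move=> /(mcs_imp (M_S4 (S44F _))) /PQ /QS.
Qed.

Lemma tcanon_truth p P : tval tcanon_rel tcanon_val p P <-> sval P p.
Proof.
elim: p P => //= [||p IHp q IHq|p IHp q IHq|p IHp|p IHp|p IHp] P.
- by split=> // /mcs_bot.
- by split=> // _; apply/mcs_theorem/tense_taut.
- by rewrite IHp IHq mcs_and.
- by rewrite IHp IHq mcs_or.
- by rewrite IHp mcs_not.
- split=> [pP|Pp Q PQ]; last exact/IHp/PQ.
  by apply: contrapT => /mcs_boxF_ex[Q /pP /IHp].
- split=> [[Q QP /IHp Qp]|/mcs_diaP/mcs_boxP_ex[Q QP nQ]].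
    by apply/mcs_diaP => /((tcanon_rel_converse _ _).1 QP) /mcs_not.
  exists Q; first exact/tcanon_rel_converse.
  by apply/IHp; apply: contrapT => /mcs_not.
Qed.

Lemma tcanon_complete p : M p <-> forall P, tval tcanon_rel tcanon_val p P.
Proof.
split=> [Mp P|valp]; first exact/tcanon_truth/mcs_theorem.
apply: contrapT => nMp; have [|P [_ nP]] := @tcanon_extend set0 [set p].
  move=> [[|x G] [D [G0 Dp GD]]]; last by have := G0 _ (mem_head _ _).
  apply: nMp; apply: tense_taut1 GD => v; rewrite tentE /=.
  by move=> /hasP[x /Dp ->].
by apply: (nP p) => //; apply/tcanon_truth.
Qed.

End TenseCanonical.

(** The frame of this model need not validate [M] under other valuations, so for GRZ.T only
    properties of definable sets can be drawn from it. *)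
Lemma tense_logic_model M : tense_logic M ->
  exists (W : Type) (R : W -> W -> Prop) (V : nat -> W -> Prop),
    preorder_on R /\ forall p, M p <-> forall w, tval R V p w.
Proof.
move=> logicM; exists (tcanon M), (@tcanon_rel M), (@tcanon_val M).
by split; [apply: tcanon_preorder|apply: tcanon_complete].
Qed.

(** * Sets represented by bi-intuitionistic formulae *)

Section Representable.
Variables (W : Type) (R : W -> W -> Prop) (v : nat -> W -> Prop).
Hypothesis preR : preorder_on R.
Hypothesis pv : forall n, persistent R (v n).
Let Rxx := preR.1.
Let Rtr := preR.2.

(* Conjunctive normal form of a Boolean combination of the up-sets defined by
   formulae: a clause [a --> b] is read pointwise in [W]. *)
Definition representable (U : W -> Prop) : Prop :=
  exists s : seq (bform * bform), forall w, U w <->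
    forall ab, ab \in s -> bval R v ab.1 w -> bval R v ab.2 w.

Lemma representable_iff (U U' : W -> Prop) :
  (forall w, U w <-> U' w) -> representable U -> representable U'.
Proof. by move=> eqU [s Us]; exists s => w; rewrite -eqU. Qed.

Lemma representable_bval p : representable (bval R v p).
Proof.
exists [:: (BTop, p)] => w; split=> [pw ab /[1!inE] /eqP-> //|].
by move=> /(_ _ (mem_head _ _)); apply.
Qed.

Lemma representable_and (U U' : W -> Prop) : representable U -> representable U' ->
  representable (fun w => U w /\ U' w).
Proof.
move=> [s Us] [s' Us']; exists (s ++ s') => w; rewrite Us Us'; split.
  by move=> [sw s'w] ab; rewrite mem_cat => /orP[/sw|/s'w].
by move=> sw; split=> ab abs; apply: sw; rewrite mem_cat abs ?orbT.
Qed.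

(** The disjunction of the clauses a --> b and c --> d is the single clause from [BAnd a c] to
    [BOr b d]. *)
Lemma representable_or (U U' : W -> Prop) : representable U -> representable U' ->
  representable (fun w => U w \/ U' w).
Proof.
move=> [s Us] [s' Us'].
exists [seq (BAnd ab.1 cd.1, BOr ab.2 cd.2) | ab <- s, cd <- s'] => w; rewrite Us Us'; split.
  move=> sw _ /allpairsP[[ab cd] /= [abs cds ->]] /= [aw cw].
  by case: sw => [/(_ _ abs aw)|/(_ _ cds cw)]; [left|right].
move=> ssw; apply: contrapT => /not_orP[nsw ns'w].
apply: nsw => ab abs aw; apply: contrapT => nbw; apply: ns'w => cd cds cw.
by case: (ssw _ (allpairs_f _ abs cds)).
Qed.

Lemma representable_not (U : W -> Prop) : representable U ->
  representable (fun w => ~ U w).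
Proof.
move=> [s Us]; suff : representable (fun w => ~
    forall ab, ab \in s -> bval R v ab.1 w -> bval R v ab.2 w).
  by apply: representable_iff => w; rewrite Us.
elim: s {U Us} => [|[a b] s IH].
  by apply: representable_iff (representable_bval BBot) => w; split=> //; apply.
have Rab : representable (fun w => bval R v a w /\ ~ bval R v b w).
  apply: representable_and; first exact: representable_bval.
  exists [:: (b, BBot)] => w; split=> [nb ab /[1!inE] /eqP-> //|].
  by move=> /(_ _ (mem_head _ _)).
apply: representable_iff (representable_or Rab IH) => w; split.
  case=> [[aw nbw] all|nall all].
    by apply: nbw; apply: (all (a, b)) aw; apply: mem_head.
  by apply: nall => cd cds; apply: all; rewrite inE cds orbT.
move=> nall; apply: contrapT => /not_orP[nab all]; apply: nall => cd.
rewrite inE => /predU1P[-> /= aw|cds].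
  by apply: contrapT => nbw; apply: nab.
by move: cd cds; apply: contrapT.
Qed.

(** The box distributes over the clauses, and boxing a pointwise implication gives precisely
    [Imp]. *)
Lemma representable_boxF (U : W -> Prop) : representable U ->
  exists p, forall w, bval R v p w <-> forall u, R w u -> U u.
Proof.
move=> [s Us]; exists (foldr (fun ab => BAnd (Imp ab.1 ab.2)) BTop s) => w.
transitivity (forall ab, ab \in s -> forall u, R w u ->
    bval R v ab.1 u -> bval R v ab.2 u); last first.
  split=> [sw u wu|Uw ab abs u wu]; last exact: (Us u).1 (Uw u wu) ab abs.
  by apply/Us => ab abs; apply: sw.
elim: s {U Us} => [|[a b] s IH] /=; first by split.
rewrite IH; split=> [[ab sw] cd|all].
  by rewrite inE => /predU1P[->|/sw].
split=> [u wu|cd cds]; first by apply: (all (a, b) (mem_head _ _)).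
by apply: all; rewrite inE cds orbT.
Qed.

(** Dually, a clause form of the complement presents the set as a union of differences, and the past
    diamond of a difference is a [Coimp]. *)
Lemma representable_diaP (U : W -> Prop) : representable U ->
  exists p, forall w, bval R v p w <-> exists2 u, R u w & U u.
Proof.
move=> /representable_not[s Us].
exists (foldr (fun ab => BOr (Coimp ab.1 ab.2)) BBot s) => w.
transitivity (exists2 ab, ab \in s & exists u,
    [/\ R u w, bval R v ab.1 u & ~ bval R v ab.2 u]); last first.
  split=> [[ab abs [u [uw au nbu]]]|[u uw Uu]].
    exists u => //; apply: contrapT => /Us /(_ _ abs au); exact: nbu.
  apply: contrapT => nex; apply: (Us u).2 (Uu) => ab abs au.
  by apply: contrapT => nbu; apply: nex; exists ab => //; exists u.
elim: s {U Us} => [|[a b] s IH] /=; first by split=> // -[].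
rewrite IH; split=> [[abw|[cd cds cdw]]|[cd]].
- by exists (a, b) => //; apply: mem_head.
- by exists cd => //; rewrite inE cds orbT.
- rewrite inE => /predU1P[->|cds cdw]; first by left.
  by right; exists cd.
Qed.

Lemma representable_tval V p : (forall n, representable (V n)) ->
  representable (tval R V p).
Proof.
move=> repV; elim: p => /= [n|||p IHp q IHq|p IHp q IHq|p IHp|p IHp|p IHp].
- exact: repV.
- exact: representable_bval BBot.
- exact: representable_bval BTop.
- exact: representable_and.
- exact: representable_or.
- exact: representable_not.
- have [q qP] := representable_boxF IHp.
  exact: representable_iff qP (representable_bval q).
- have [q qP] := representable_diaP IHp.
  exact: representable_iff qP (representable_bval q).
Qed.

Lemma representable_interior V : (forall n, representable (V n)) ->
  exists g, forall p w, bval R v (g p) w <-> forall u, R w u -> tval R V p u.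
Proof.
move=> repV; have /choice[g gP] : forall p, exists q, forall w,
    bval R v q w <-> forall u, R w u -> tval R V p u.
  by move=> p; apply: representable_boxF; apply: representable_tval.
by exists g.
Qed.

Lemma representable_finite (U : W -> Prop) : representable U ->
  exists s : seq bform, forall w u,
    {in s, forall c, bval R v c w <-> bval R v c u} -> (U w <-> U u).
Proof.
move=> [s Us]; exists (map fst s ++ map snd s) => w u eqwu; rewrite !Us.
have eq1 ab : ab \in s -> bval R v ab.1 w <-> bval R v ab.1 u.
  by move=> abs; apply: eqwu; rewrite mem_cat map_f.
have eq2 ab : ab \in s -> bval R v ab.2 w <-> bval R v ab.2 u.
  by move=> abs; apply: eqwu; rewrite mem_cat [X in _ || X]map_f ?orbT.
by split=> sw ab abs /(eq1 _ abs) /(sw _ abs) /(eq2 _ abs).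
Qed.
End Representable.

(** * The Grzegorczyk property *)

(** What a Grzegorczyk axiom demands of one set; stating it set by set suits models in which only
    some sets are values of formulae. *)
Definition grz_set (W : Type) (R : W -> W -> Prop) (U : W -> Prop) : Prop :=
  forall w, U w -> exists v, [/\ R w v, U v &
    forall u, R v u -> (exists2 x, R u x & U x) -> U u].

Definition converse (W : Type) (R : W -> W -> Prop) (w u : W) : Prop := R u w.

(** By contraposition: where [BoxF (timp p (BoxF p))] holds, the complement of p is not met again
    once left. Hence the axiom speaks of the complement of its variable. *)
Lemma tval_grzF W (R : W -> W -> Prop) V : preorder_on R ->
  (forall w, tval R V grzF w) <-> grz_set R (fun w => ~ V 0 w).
Proof.
move=> [Rxx Rtr]; split=> [valid w nVw|grz w].
  apply: contrapT => nex; case: (valid w) => //=; apply=> u wu /=.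
  case: (pselect (V 0 u)) => Vu; [by right|left=> box; apply: nex].
  exists u; split=> // x ux [y xy nVy] Vx.
  by case: (box x ux) => [/(_ Vx)//|/(_ y xy)].
apply/tval_timp => /= box; apply: contrapT => /grz[u [wu nVu clos]].
case: (box u wu) => //; apply=> x ux.
case: (pselect (V 0 x)) => Vx; [right=> y xy|by left].
by apply: contrapT => nVy; apply: (clos x ux) Vx; exists y.
Qed.

Lemma tval_grzP W (R : W -> W -> Prop) V :
  (forall w, tval R V grzP w) <-> grz_set (converse R) (V 0).
Proof.
split=> [valid w Vw|grz w].
  have [//|[u uw [Vu clos]]] := valid w.
  exists u; split=> // x xu [y yx Vy]; apply: contrapT => nVx; apply: clos.
  by exists x => //; split=> //; exists y.
apply/tval_timp => /grz[u [uw Vu clos]]; exists u => //; split=> //.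
by move=> [x xu [[y yx Vy]]]; apply; apply: clos => //; exists y.
Qed.

Lemma grz_set_ranked W (R : W -> W -> Prop) (m : W -> nat) (N : nat) (U : W -> Prop) :
  preorder_on R -> (forall w, m w <= N) -> (forall w u, R w u -> m w <= m u) ->
  (forall w u, R w u -> m w = m u -> (U w <-> U u)) -> grz_set R U.
Proof.
move=> [Rxx Rtr] leN mono same w Uw.
pose P k := `[< exists v, [/\ R w v, U v & m v = k] >].
have exP : exists k, P k by exists (m w); apply/asboolP; exists w.
have bndP k : P k -> k <= N by move=> /asboolP[v [_ _ <-]].
case: (ex_maxnP exP bndP) => k /asboolP[v [wv Uv mv]] maxk.
exists v; split=> // u vu [x ux Ux].
have mx : m x <= m v.
  rewrite mv; apply: maxk; apply/asboolP; exists x; split=> //.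
  by apply: (Rtr _ v) => //; apply: Rtr ux.
apply/(same v u vu) => //; apply/eqP; rewrite eqn_leq mono //=.
by apply: leq_trans mx; apply: mono.
Qed.

Section RepresentableGrz.
Variables (W : Type) (R : W -> W -> Prop) (v : nat -> W -> Prop).
Hypothesis preR : preorder_on R.
Hypothesis pv : forall n, persistent R (v n).

(* Along [R] the set of formulae of a finite list that are forced can only grow,
   so their number is a rank, and U is constant where the rank is. *)
Lemma representable_grz (U : W -> Prop) : representable R v U ->
  grz_set R U /\ grz_set (converse R) U.
Proof.
move=> /representable_finite[s sU].
pose m w := count (fun c => `[< bval R v c w >]) s.
have mono w u : R w u -> m w <= m u.
  move=> wu; apply: sub_count => c /asboolP cw; apply/asboolP.
  by apply: bval_persistent wu cw.
have same w u : R w u -> m w = m u -> (U w <-> U u).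
  move=> wu; rewrite /m => eqm; apply: sU.
  have sub c : bval R v c w -> bval R v c u by apply: bval_persistent.
  elim: s {mono} @m eqm => //= c s IH.
  have mono : count (fun c => `[< bval R v c w >]) s <=
      count (fun c => `[< bval R v c u >]) s.
    by apply: sub_count => d /asboolP dw; apply/asboolP/sub.
  case: asboolP => cw; case: asboolP => cu eqm d.
  - by rewrite inE => /predU1P[->|]; [split|apply: IH; case: eqm].
  - by case: cu; apply: sub.
  - by exfalso; move: mono; rewrite -[count _ s]add0n eqm add1n ltnn.
  - by rewrite inE => /predU1P[->|]; [split|apply: IH; case: eqm].
have leN w : m w <= size s by apply: count_size.
split; first exact: grz_set_ranked leN mono same.
(* Downwards the number of forced formulae shrinks, so its distance to the length of the list serves
   as rank. *)
apply: (@grz_set_ranked _ _ (fun w => size s - m w) (size s)).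
- by split=> [w|w u x uw xu]; [apply: preR.1|apply: preR.2 xu uw].
- by move=> w; apply: leq_subr.
- by move=> w u /mono; apply: leq_sub2l.
- move=> w u uw eqm; apply: iff_sym; apply: (same u w uw).
  by rewrite -(subKn (leN u)) -eqm subKn.
Qed.
End RepresentableGrz.

(** * Rule systems *)

Lemma map_rule_pair (A B : choiceType) (f : A -> B) G D :
  map_rule f (G, D) = ([fset f p | p in G], [fset f p | p in D])%fset.
Proof. by []. Qed.

Lemma map_rule_comp (A B C : choiceType) (f : B -> C) (g : A -> B) r :
  map_rule f (map_rule g r) = map_rule (f \o g) r.
Proof. by rewrite /map_rule /= -!imfset_comp. Qed.

Lemma map_rule_id (A : choiceType) (r : rule A) : map_rule id r = r.
Proof. by case: r => G D; rewrite /map_rule /= !imfset_id. Qed.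

Lemma map_theorem_rule (A B : choiceType) (f : A -> B) p :
  map_rule f (theorem_rule p) = theorem_rule (f p).
Proof. by rewrite /map_rule /= imfset0 imfset_fset1. Qed.

Section RuleSystem.
Variables (A : choiceType) (sub : (nat -> A) -> A -> A) (S : set (rule A)).
Hypothesis rsS : rule_system sub S.

Lemma rule_weaken G D G' D' : (G `<=` G')%fset -> (D `<=` D')%fset ->
  S (G, D) -> S (G', D').
Proof.
move=> /fsetUidPr <- /fsetUidPr <-; case: rsS => _ _ wk _; exact: wk.
Qed.

(** Cut removes one formula at a time, so the premises still to be eliminated are carried as a list
    beside [G2]. *)
Lemma rule_cut_left G1 G2 D : S (G1, D) ->
  (forall p, p \in G1 -> S (G2, [fset p]%fset)) -> S (G2, D).
Proof.
move=> G1D G12; have [_ _ _ cut] := rsS.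
suff gen (s : seq A) : {subset s <= G1} -> S (G2 `|` [fset p in s], D)%fset -> S (G2, D).
  apply: (gen (enum_fset G1)) => //; apply: rule_weaken G1D => //.
  by apply/fsubsetP => p pG; rewrite !inE pG orbT.
elim: s => [_|p s IH sG sD].
  by apply: rule_weaken => //; apply/fsubsetP => p; rewrite !inE orbF.
apply: IH => [q qs|]; first by apply: sG; rewrite inE qs orbT.
apply: (cut _ _ p).
  apply: rule_weaken (G12 p (sG _ (mem_head _ _))).
    exact: fsubsetUl.
  exact: fsubsetUl.
apply: rule_weaken sD => //; apply/fsubsetP => q; rewrite !inE.
by case/or3P => ->; rewrite ?orbT.
Qed.

Lemma rule_cut_right G D1 D2 : S (G, D1) ->
  (forall p, p \in D1 -> S ([fset p]%fset, D2)) -> S (G, D2).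
Proof.
move=> GD1 D12; have [_ _ _ cut] := rsS.
suff gen (s : seq A) : {subset s <= D1} -> S (G, D2 `|` [fset p in s])%fset -> S (G, D2).
  apply: (gen (enum_fset D1)) => //; apply: rule_weaken GD1 => //.
  by apply/fsubsetP => p pG; rewrite !inE pG orbT.
elim: s => [_|p s IH sG sD].
  by apply: rule_weaken => //; apply/fsubsetP => p; rewrite !inE orbF.
apply: IH => [q qs|]; first by apply: sG; rewrite inE qs orbT.
apply: (cut _ _ p).
  apply: rule_weaken sD => //; apply/fsubsetP => q; rewrite !inE.
  by case/or3P => ->; rewrite ?orbT.
apply: rule_weaken (D12 p (sG _ (mem_head _ _))).
  exact: fsubsetUl.
exact: fsubsetUl.
Qed.

(** A rule survives replacing its formulae by interderivable ones: conclusions are cut on the right,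
    premises on the left. *)
Lemma rule_transfer (B : choiceType) (f g : B -> A) r :
  (forall p, p \in r.1 -> S ([fset g p], [fset f p])%fset) ->
  (forall p, p \in r.2 -> S ([fset f p], [fset g p])%fset) ->
  S (map_rule f r) -> S (map_rule g r).
Proof.
move=> gf fg Sf; apply: (@rule_cut_left [fset f p | p in r.1]%fset).
  apply: rule_cut_right Sf _ => _ /imfsetP[p /= pr ->].
  apply: rule_weaken (fg p pr) => //; rewrite fsub1set; exact: in_imfset.
move=> _ /imfsetP[p /= pr ->]; apply: rule_weaken (gf p pr) => //.
by rewrite fsub1set; apply: in_imfset.
Qed.

Lemma rule_theorem_mp p q : S (theorem_rule p) -> S ([fset p], [fset q])%fset ->
  S (theorem_rule q).
Proof.
by move=> Sp Spq; apply: (rule_cut_right Sp) => _ /fset1P->.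
Qed.
End RuleSystem.

(** * Admissible rules of a logic *)

Definition theorems (A : choiceType) (S : set (rule A)) : set A :=
  [set p | S (theorem_rule p)].

(** Attaches a rule system to a logic, so that statements about logics can be drawn from those about
    rule systems. Quantifying over [s] builds in closure under substitution. *)
Definition admissible (A : choiceType) (sub : (nat -> A) -> A -> A) (L : set A) :
    set (rule A) :=
  [set r | forall s, (forall p, p \in r.1 -> L (sub s p)) ->
     exists2 p, p \in r.2 & L (sub s p)].

Lemma admissible_rule_system (A : choiceType) (sub : (nat -> A) -> A -> A) L :
  (forall s s' p, sub s (sub s' p) = sub (fun n => sub s (s' n)) p) ->
  rule_system sub (admissible sub L).
Proof.
move=> sub_comp; split.
- move=> s [G D] GD s' /= LG; have [|p pD Lp] := GD (fun n => sub s' (s n)).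
    by move=> p pG; rewrite -sub_comp; apply: LG; apply: in_imfset.
  by exists (sub s p); [apply: in_imfset|rewrite sub_comp].
- by move=> p s /= Lp; exists p; [apply: fset11|apply/Lp/fset11].
- move=> G D G' D' GD s /= LG; have [|p pD Lp] := GD s.
    by move=> p pG; apply: LG; rewrite inE pG.
  by exists p => //; rewrite inE; apply/orP; left.
- move=> G D p GpD pGD s /= LG; have [//|q /fset1UP[->|qD] Lq] := GpD s.
    by apply: pGD => r /fset1UP[->|/LG].
  by exists q.
Qed.

Lemma theorems_admissible (A : choiceType) (sub : (nat -> A) -> A -> A) L v :
  (forall p, sub v p = p) -> (forall s p, L p -> L (sub s p)) ->
  theorems (admissible sub L) = L.
Proof.
move=> sub_id subL; apply/seteqP; split=> p.
  move=> /(_ v)[p'|q /fset1P ->]; first by rewrite inE.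
  by rewrite sub_id.
by move=> Lp s _; exists p; [apply: fset11|apply: subL].
Qed.

Lemma bsubst_comp s s' p : bsubst s (bsubst s' p) = bsubst (fun n => bsubst s (s' n)) p.
Proof. by elim: p => //= p -> q ->. Qed.

Lemma bsubst_id p : bsubst BVar p = p.
Proof. by elim: p => //= p -> q ->. Qed.

Lemma tsubst_comp s s' p : tsubst s (tsubst s' p) = tsubst (fun n => tsubst s (s' n)) p.
Proof. by elim: p => //= [p -> q ->|p -> q ->|p ->|p ->|p ->]. Qed.

Lemma tsubst_id p : tsubst TVar p = p.
Proof. by elim: p => //= [p -> q ->|p -> q ->|p ->|p ->|p ->]. Qed.

Lemma admissible_bsi L : bsi_logic L -> bsi_rule_system (admissible bsubst L).
Proof.
move=> [[sb mp dn] biL]; split.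
- apply: admissible_rule_system; exact: bsubst_comp.
- by move=> _ [p bp <-] s _; exists p; [apply: fset11|apply/sb/biL].
- move=> p q s /= LG; exists q; first exact: fset11.
  by apply: (mp (bsubst s p)); [apply/LG/fset21|apply/(LG (Imp p q))/fset22].
- move=> p s /= LG; exists (bneg (bconeg p)); first exact: fset11.
  exact/dn/LG/fset11.
Qed.

Lemma admissible_tense M : tense_logic M -> tense_rule_system (admissible tsubst M).
Proof.
move=> [[sb mp nF nP] SM]; split.
- apply: admissible_rule_system; exact: tsubst_comp.
- by move=> _ [p bp <-] s _; exists p; [apply: fset11|apply/sb/SM].
- move=> p q s /= LG; exists q; first exact: fset11.
  by apply: (mp (tsubst s p)); [apply/LG/fset21|apply/(LG (timp p q))/fset22].
- move=> p s /= LG; exists (BoxF p); first exact: fset11.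
  exact/nF/LG/fset11.
- move=> p s /= LG; exists (BoxP p); first exact: fset11.
  exact/nP/LG/fset11.
Qed.

Lemma bsi_rule_mp L p q : bsi_rule_system L -> biIPC (Imp p q) ->
  L ([fset p], [fset q])%fset.
Proof.
move=> [rsL biL mp _] bpq; apply: (rule_cut_left rsL (mp p q)) => r.
rewrite !inE => /orP[]/eqP->; first by case: rsL.
by apply: (rule_weaken rsL) (biL _ _); [exact: fsub0set|exact: fsubset_refl|exists (Imp p q)].
Qed.

Lemma tense_rule_mp M p q : tense_rule_system M -> theorems M (timp p q) ->
  M ([fset p], [fset q])%fset.
Proof.
move=> [rsM SM mp _ _] Mpq; apply: (rule_cut_left rsM (mp p q)) => r.
rewrite !inE => /orP[]/eqP->; first by case: rsM.
by apply: (rule_weaken rsM) Mpq; [exact: fsub0set|exact: fsubset_refl].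
Qed.

Lemma theorems_bsi L : bsi_rule_system L -> bsi_logic (theorems L).
Proof.
move=> LC; have [rsL biL mp dn] := LC; split; last first.
  by move=> p bp; apply: biL; exists p.
have [sb _ wk _] := rsL; split.
- by move=> s p /(sb s); rewrite map_theorem_rule.
- move=> p q Lp Lpq; apply: (rule_cut_left rsL (mp p q)) => r.
  by rewrite !inE => /orP[]/eqP->.
- by move=> p Lp; apply: (rule_theorem_mp rsL Lp).
Qed.

Lemma theorems_tense M : tense_rule_system M -> tense_logic (theorems M).
Proof.
move=> MC; have [rsM SM mp nF nP] := MC; split; last first.
  by move=> p bp; apply: SM; exists p.
have [sb _ wk _] := rsM; split.
- by move=> s p /(sb s); rewrite map_theorem_rule.
- move=> p q Lp Lpq; apply: (rule_cut_left rsM (mp p q)) => r.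
  by rewrite !inE => /orP[]/eqP->.
- by move=> p Lp; apply: (rule_theorem_mp rsM Lp).
- by move=> p Lp; apply: (rule_theorem_mp rsM Lp).
Qed.

(** * The translation *)

(** Replaces derivations in S4.t by arguments on preorders, since the canonical model is one. *)
Lemma S4t_valid p :
  (forall W (R : W -> W -> Prop) V w, preorder_on R -> tval R V p w) -> S4t p.
Proof.
move=> valid; have [W [R [V [preR complete]]]] := tense_logic_model S4t_tense.
by apply/complete => w; apply: valid.
Qed.

(** The translation boxes each variable, but the value of [Tr (s n)] is already an up-set, so this
    box changes nothing. *)
Lemma Tr_bsubst W (R : W -> W -> Prop) V s p w : preorder_on R ->
  tval R V (tsubst (fun n => Tr (s n)) (Tr p)) w <-> tval R V (Tr (bsubst s p)) w.
Proof.
move=> preR; rewrite tval_subst // !tval_Tr // bval_subst //.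
suff -> : (fun n w => forall u, R w u -> tval R V (Tr (s n)) u) =
    (fun n => bval R (fun n w => forall u, R w u -> V n u) (s n)) by [].
apply/funext => n; apply/funext => x; apply/propext; split=> [all|bx u xu].
  by apply/tval_Tr/all/preR.1.
apply/tval_Tr => //; apply: bval_persistent xu bx => // m.
exact: boxF_persistent.
Qed.

Lemma biIPC_Tr p : biIPC p -> S4t (Tr p).
Proof.
move=> bp; apply: S4t_valid => W R V w preR; apply/tval_Tr => //.
by apply: bval_sound bp => // n; apply: boxF_persistent.
Qed.

Lemma rho_RE M r : rho_R M r = M (map_rule Tr r).
Proof. by []. Qed.

Lemma rho_R_bsi M : tense_rule_system M -> bsi_rule_system (rho_R M).
Proof.
move=> MC; have [rsM SM mp nF nP] := MC; have [sb rf wk cut] := rsM.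
have Mrule p q : (forall W (R : W -> W -> Prop) V w, preorder_on R ->
    tval R V p w -> tval R V q w) -> M ([fset p], [fset q])%fset.
  move=> pq; apply: tense_rule_mp => //; apply: (theorems_tense MC).2.
  apply: S4t_valid => W R V w preR.
  by apply/tval_timp/pq.
split.
- split=> [s r|p|G D G' D'|G D p]; rewrite !rho_RE.
  (* The tense instance under [Tr \o s] agrees with the translated instance up to
     interderivability. *)
  + move=> /(sb (fun n => Tr (s n))); rewrite !map_rule_comp; apply: (rule_transfer rsM) => p _ /=.
      by apply: Mrule => W R V w preR ?; apply/Tr_bsubst.
    by apply: Mrule => W R V w preR ?; apply/Tr_bsubst.
  + by rewrite map_rule_pair !imfset_fset1.
  + by rewrite !map_rule_pair !imfsetU; apply: wk.
  + by rewrite !map_rule_pair !imfsetU1; apply: cut.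
- by move=> _ [p bp <-] /=; rewrite rho_RE map_theorem_rule; apply: SM; exists (Tr p) => //; apply: biIPC_Tr.
- move=> p q; rewrite rho_RE map_rule_pair imfset_fset2 imfset_fset1 /=.
  apply: (rule_cut_left rsM (mp (Tr p) (Tr q))) => r; rewrite !inE => /orP[]/eqP->.
    by apply: (rule_weaken rsM) (rf (Tr p)); rewrite ?fsubset_refl // fsub1set fset21.
  have /(rule_weaken rsM) : M ([fset Tr (Imp p q)], [fset timp (Tr p) (Tr q)])%fset.
    by apply: Mrule => W R V w preR; apply; apply: preR.1.
  by apply; rewrite ?fsubset_refl // fsub1set fset22.
- move=> p; rewrite rho_RE map_rule_pair !imfset_fset1 /=.
  (* Necessitation for both boxes yields [BoxF (BoxP (Tr p))], which says the same as the
     translation of [bneg (bconeg p)]. *)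
  apply: (rule_cut_right rsM (nP (Tr p))) => _ /fset1P->.
  apply: (rule_cut_right rsM (nF (BoxP (Tr p)))) => _ /fset1P->.
  apply: Mrule => W R V w preR /= box u wu; left=> -[x xu [_ np]].
  by apply: (box u wu); exists x.
Qed.

(** The smallest system is by definition the intersection of [NExt_R X], so closure under
    intersections applies. *)
Lemma smallest_tense_rule_system X : tense_rule_system (smallest tense_rule_system X).
Proof. by have [] := @NExt_R_meet X (NExt_R X) (fun _ h => h). Qed.

Lemma smallest_tense_logic X : tense_logic (smallest tense_logic X).
Proof. by have [] := @NExt_meet X (NExt X) (fun _ h => h). Qed.

(** * Conservativity of the translation *)

Section Conservative.
Variables (W : Type) (R : W -> W -> Prop) (v : nat -> W -> Prop).
Hypothesis preR : preorder_on R.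
Hypothesis pv : forall n, persistent R (v n).

(** Representable valuations make both Grzegorczyk axioms hold, and substitution preserves this
    because tense formulae take representable values. *)
Lemma GRZT_representable V p w : (forall n, representable R v (V n)) -> GRZT p ->
  tval R V p w.
Proof.
move=> repV; suff: GRZT `<=` [set p | forall V, (forall n, representable R v (V n)) ->
    forall w, tval R V p w] by move=> sub /sub; apply.
apply: smallest_sub.
  split=> [|q Sq V' _ x]; last exact: S4t_sound.
  split=> [s q qt V' rV' x|q r qt qrt V' rV' x|q qt V' rV' x u _|q qt V' rV' x].
  - by apply/tval_subst => //; apply: qt => n; apply: representable_tval.
  - by move: (qrt V' rV' x) => /tval_timp; apply; apply: qt.
  - exact: qt.
  - by apply/tval_BoxP => u _; apply: qt.
move=> q [Sq V' _ x|[]-> V' rV' x]; first exact: S4t_sound.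
  have [gF _] := representable_grz preR pv (representable_not (rV' 0)).
  exact: (tval_grzF V' preR).2 gF x.
have [_ gP] := representable_grz preR pv (rV' 0).
exact: (tval_grzP R V').2 gP x.
Qed.
End Conservative.

Lemma bcanon_imp p q : (forall w, bval bcanon_rel bcanon_val p w ->
  bval bcanon_rel bcanon_val q w) -> biIPC (Imp p q).
Proof. by move=> pq; apply/biIPC_complete => w u _; apply: pq. Qed.

Notation brep := (representable bcanon_rel bcanon_val).

(* [r] holds in the Boolean extension of the bi-Heyting algebra of [L]: its
   elements are the representable sets, [g] is the interior operator for F, and a
   set counts as valid when the formula of its interior does. *)
Definition tense_extension (L : set (rule bform)) : set (rule tform) :=
  [set r | forall V g, (forall n, brep (V n)) ->
    (forall p w, bval bcanon_rel bcanon_val (g p) w <->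
       forall u, bcanon_rel w u -> tval bcanon_rel V p u) ->
    L (map_rule g r)].

Section TenseExtension.
Variable L : set (rule bform).
Hypothesis LC : bsi_rule_system L.

Let preR := bcanon_preorder.
Let pv := bcanon_val_persistent.

Let bimp p q : (forall w, bval bcanon_rel bcanon_val p w ->
  bval bcanon_rel bcanon_val q w) -> L ([fset p], [fset q])%fset.
Proof. by move=> /bcanon_imp; apply: bsi_rule_mp LC. Qed.

Lemma tense_extension_theorem p :
  (forall V w, (forall n, brep (V n)) -> tval bcanon_rel V p w) ->
  tense_extension L (theorem_rule p).
Proof.
move=> valid V g repV gP; rewrite map_theorem_rule.
have [_ biL _ _] := LC; apply: biL; exists (g p) => //.
by apply/biIPC_complete => w; apply/gP => u _; apply: valid.
Qed.

Lemma tense_extension_tense : tense_rule_system (tense_extension L).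
Proof.
have [rsL biL mp dn] := LC; have [sb rf wk cut] := rsL; split.
- split=> [s r Lr|p|G D G' D' GD|G D p GpD pGD] V g repV gP.
  + rewrite map_rule_comp.
    (* Substituting amounts to evaluating under the values of [s], with [g \o tsubst s] as interior
       operator. *)
    apply: (Lr (fun n => tval bcanon_rel V (s n))) => [n|p w].
      exact: representable_tval.
    by rewrite gP; split=> pw u wu; apply/tval_subst/pw.
  + by rewrite map_rule_pair !imfset_fset1.
  + by rewrite map_rule_pair !imfsetU; apply: wk; exact: GD repV gP.
  + rewrite map_rule_pair; apply: (cut _ _ (g p)).
      by rewrite -imfsetU1; apply: GpD repV gP.
    by rewrite -imfsetU1; apply: pGD repV gP.
- by move=> _ [p Sp <-]; apply: tense_extension_theorem => V w _; apply: S4t_sound.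
- move=> p q V g repV gP; rewrite map_rule_pair imfset_fset2 imfset_fset1.
  apply: (rule_cut_left rsL (mp (g p) (g q))) => r; rewrite !inE => /orP[]/eqP->.
    by apply: (rule_weaken rsL) (rf (g p)); rewrite ?fsubset_refl // fsub1set fset21.
  have /(rule_weaken rsL) : L ([fset g (timp p q)], [fset Imp (g p) (g q)])%fset.
    apply: bimp => w /gP pq u wu /gP pu; apply/gP => x ux.
    have /tval_timp := pq x (preR.2 _ _ _ wu ux); apply; exact: pu.
  by apply; rewrite ?fsubset_refl // fsub1set fset22.
- move=> p V g repV gP; rewrite map_rule_pair !imfset_fset1.
  apply: bimp => w /gP pw; apply/gP => u wu x ux; apply: pw.
  exact: preR.2 wu ux.
- move=> p V g repV gP; rewrite map_rule_pair !imfset_fset1.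
  (* The rule for coimplication supplies the past box: [bneg (bconeg (g p))] at [w] forces [g p] at
     every point below a point above [w]. *)
  apply: (rule_cut_right rsL (dn (g p))) => _ /fset1P->.
  apply: bimp => w pw; apply/gP => u wu; apply/tval_BoxP => x xu.
  apply: contrapT => npx; apply: (pw u wu); exists x; split=> // /gP px.
  by apply: npx; apply: px; apply: preR.1.
Qed.

Lemma tense_extension_GRZT_R : NExt_R GRZT_R (tense_extension L).
Proof.
split; first exact: tense_extension_tense.
apply: smallest_sub; first exact: tense_extension_tense.
move=> _ [p Gp <-]; apply: tense_extension_theorem => V w repV.
exact: GRZT_representable preR pv _ _ _ repV Gp.
Qed.

Let interior_Tr V g : (forall p w, bval bcanon_rel bcanon_val (g p) w <->
       forall u, bcanon_rel w u -> tval bcanon_rel V p u) ->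
  forall p w, bval bcanon_rel bcanon_val (g (Tr p)) w <->
    bval bcanon_rel bcanon_val (bsubst (fun n => g (TVar n)) p) w.
Proof.
move=> gP p w; rewrite gP bval_subst //.
suff -> : (fun n => bval bcanon_rel bcanon_val (g (TVar n))) =
    (fun n w => forall u, bcanon_rel w u -> V n u).
  split=> [pw|pw u wu]; first exact/tval_Tr/pw/preR.1.
  by apply/tval_Tr => //; apply: bval_persistent wu pw => // n; apply: boxF_persistent.
by apply/funext => n; apply/funext => x; apply/propext/gP.
Qed.

(** Forwards, the canonical valuation makes [g (Tr p)] equivalent to [p]. Backwards, [g (Tr p)] is
    equivalent to a substitution instance of [p], and [L] is closed under substitution. *)
Lemma tense_extension_Tr r : tense_extension L (Tr_rule r) <-> L r.
Proof.
have [rsL _ _ _] := LC; split=> [Lr|Lr V g repV gP].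
  have repv n : brep (bcanon_val n) by apply: (representable_bval _ _ (BVar n)).
  have [g gP] := representable_interior repv.
  move: (Lr _ _ repv gP); rewrite /Tr_rule map_rule_comp -[X in _ -> L X]map_rule_id.
  have gE p w : bval bcanon_rel bcanon_val (g (Tr p)) w <-> bval bcanon_rel bcanon_val p w.
    rewrite (interior_Tr gP) bval_subst //.
    suff -> : (fun n => bval bcanon_rel bcanon_val (g (TVar n))) = bcanon_val by [].
    apply/funext => n; apply/funext => x; apply/propext; rewrite gP; split.
      by apply; apply: preR.1.
    by move=> nx u xu; apply: pv xu nx.
  by apply: (rule_transfer rsL) => p _ /=; apply: bimp => w /gE.
have [sb _ _ _] := rsL; move: (sb (fun n => g (TVar n)) _ Lr).
rewrite /Tr_rule map_rule_comp; apply: (rule_transfer rsL) => p _ /=.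
  by apply: bimp => w /(interior_Tr gP).
by apply: bimp => w ?; apply/(interior_Tr gP).
Qed.
End TenseExtension.

(** [tense_extension L] contains [sigma_R L], yet the translated rules in it all come from [L]. *)
Lemma rho_R_sigma_R L : bsi_rule_system L -> rho_R (sigma_R L) = L.
Proof.
move=> LC; apply/seteqP; split=> r; last first.
  by move=> Lr; apply: sub_gen_smallest; right; exists r.
move=> sr; apply/(tense_extension_Tr LC); move: sr.
apply: smallest_sub; first exact: tense_extension_tense.
move=> q [/(tense_extension_GRZT_R LC).2 //|[q' Lq' <-]].
exact/(tense_extension_Tr LC).
Qed.

Lemma rho_theorems M : theorems (rho_R M) = rho (theorems M).
Proof.
apply/seteqP; split=> p; rewrite /theorems /rho /= rho_RE map_theorem_rule; exact.
Qed.

Lemma rho_bsi M : tense_logic M -> bsi_logic (rho M).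
Proof.
move=> MC; have [[sb _ _ _] _] := MC.
rewrite -(theorems_admissible tsubst_id sb) -rho_theorems.
exact/theorems_bsi/rho_R_bsi/admissible_tense.
Qed.

Lemma rho_sigma L : bsi_logic L -> rho (sigma L) = L.
Proof.
move=> LC; apply/seteqP; split=> p; last first.
  by move=> Lp; apply: sub_gen_smallest; right; exists p.
have [[sb _ _] _] := LC; have aC := admissible_bsi LC.
(* [L] consists of the theorems of its admissible rules, so it suffices that the theorems of
   [sigma_R] of those rules form a tense logic containing [GRZT] and the translations of [L]. *)
rewrite -[X in _ -> X p](theorems_admissible bsubst_id sb).
rewrite -(rho_R_sigma_R aC) rho_theorems; apply: smallest_sub.
  exact/theorems_tense/smallest_tense_rule_system.
move=> q [Gq|[q' Lq' <-]].
  by apply: sub_gen_smallest; left; apply: sub_gen_smallest; exists q.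
rewrite /theorems /= -(map_theorem_rule Tr); apply: sub_gen_smallest; right.
exists (theorem_rule q') => //.
by rewrite -(theorems_admissible bsubst_id sb) in Lq'.
Qed.

(** * Reduction of tense formulae to translations *)

(** The tense counterpart of [representable]: on a preorder the values are Boolean combinations of
    up-sets. *)
Fixpoint boxed_combination (p : tform) : bool :=
  match p with
  | TBot | TTop => true
  | TAnd p q | TOr p q => boxed_combination p && boxed_combination q
  | Not p => boxed_combination p
  | BoxF (TVar _) => true
  | _ => false
  end.

(** With variables read as their interiors, each [t n] has a representable value; hence so has [p]
    after substitution, and the interior of a representable set is defined by some [q]. *)
Lemma boxed_combination_Tr t p : (forall n, boxed_combination (t n)) ->
  exists q, S4t (tiff (BoxF (tsubst t p)) (Tr q)).
Proof.
move=> bt; have [W [R [V [preR complete]]]] := tense_logic_model S4t_tense.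
pose v n w := forall u, R w u -> V n u.
have bcR q : boxed_combination q -> representable R v (tval R V q).
  elim: q => //= [_|_|q IHq r IHr /andP[/IHq Rq /IHr Rr]|q IHq r IHr /andP[/IHq Rq /IHr Rr]
    |q IHq /IHq Rq|[] // n _ _].
  - exact: representable_bval _ _ BBot.
  - exact: representable_bval _ _ BTop.
  - exact: representable_and.
  - exact: representable_or.
  - exact: representable_not.
  - exact: representable_bval _ _ (BVar n).
have [g gP] := @representable_interior _ R v _ (fun n => bcR _ (bt n)).
exists (g p); apply/complete => w; apply/tval_tiff; rewrite tval_Tr // gP.
by split=> pw u wu; apply/tval_subst/pw.
Qed.

(** * Boolean classes of sets and finite case distinctions *)

Definition boolean_class (W : Type) (K : (W -> Prop) -> Prop) : Prop :=
  [/\ forall U U', (forall w, U w <-> U' w) -> K U -> K U',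
      forall P : Prop, K (fun=> P),
      forall U U', K U -> K U' -> K (fun w => U w /\ U' w) &
      forall U, K U -> K (fun w => ~ U w)].

Section BooleanClass.
Variables (W : Type) (K : (W -> Prop) -> Prop).
Hypothesis bK : boolean_class K.

Lemma boolean_class_or U U' : K U -> K U' -> K (fun w => U w \/ U' w).
Proof.
have [ext _ and not] := bK => KU KU'.
apply: ext (not _ (and _ _ (not _ KU) (not _ KU'))) => w; split.
  by move=> nor; apply: contrapT => /not_orP.
by move=> [?|?] [].
Qed.

Lemma boolean_class_imp U U' : K U -> K U' -> K (fun w => U w -> U' w).
Proof.
have [ext _ _ not] := bK => KU KU'.
apply: ext (boolean_class_or (not _ KU) KU') => w; split=> [[]//|UU'].
by case: (pselect (U w)) => [/UU'|]; [right|left].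
Qed.

Lemma boolean_class_iff U (P : Prop) : K U -> K (fun w => U w <-> P).
Proof.
have [ext cst and _] := bK => KU.
exact: and (boolean_class_imp KU (cst P)) (boolean_class_imp (cst P) KU).
Qed.

Lemma boolean_class_all (T : eqType) (s : seq T) (U : T -> W -> Prop) :
  (forall c, c \in s -> K (U c)) -> K (fun w => forall c, c \in s -> U c w).
Proof.
have [ext cst and _] := bK.
elim: s => [_|a s IH Ks]; first by apply: ext (cst True) => w; split.
apply: ext (and _ _ (Ks a (mem_head a s)) (IH _)) => [w|c cs]; last first.
  by apply: Ks; rewrite inE cs orbT.
split=> [[Uaw sw] c|sw]; first by rewrite inE => /predU1P[->|/sw].
by split=> [|c cs]; apply: sw; rewrite inE ?eqxx ?cs ?orbT.
Qed.

Lemma boolean_class_if U U' U'' : K U -> K U' -> K U'' ->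
  K (fun w => if `[< U w >] then U' w else U'' w).
Proof.
have [ext _ and not] := bK => KU KU' KU''.
apply: ext (boolean_class_or (and _ _ KU KU') (and _ _ (not _ KU) KU'')) => w.
by case: asboolP => Uw; split=> [[[]|[]]|]; [|by []|by left|by []| |by right].
Qed.
End BooleanClass.

(** A choice made by testing finitely many conditions, so that its preimages stay in any Boolean
    class containing them. *)
Fixpoint first_match (W T : Type) (d : T) (C : T -> W -> Prop) (s : seq T) (w : W) : T :=
  if s is j :: s' then if `[< C j w >] then j else first_match d C s' w else d.

Lemma first_matchP (W : Type) (T : eqType) (d : T) (C : T -> W -> Prop) s w j :
  j \in s -> C j w -> C (first_match d C s w) w.
Proof.
elim: s => //= k s IH; rewrite inE => /predU1P[<-|js] Cjw; first by rewrite asboolT.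
by case: asboolP => // _; apply: IH.
Qed.

Lemma first_match_class (W : Type) (K : (W -> Prop) -> Prop) (T : eqType) (d : T)
    (C : T -> W -> Prop) s (P : T -> Prop) : boolean_class K ->
  (forall j, j \in s -> K (C j)) -> K (fun w => P (first_match d C s w)).
Proof.
move=> bK; have [ext cst _ _] := bK; elim: s => [_|j s IH Ks] /=; first exact: cst.
have KIH := IH (fun k ks => Ks k (mem_behead (s := j :: s) ks)).
apply: ext (boolean_class_if bK (Ks j (mem_head j s)) (cst (P j)) KIH) => w.
by case: asboolP.
Qed.

(** * Subformulae *)

Definition immediate (p : tform) : seq tform :=
  match p with
  | TAnd p q | TOr p q => [:: p; q]
  | Not p | BoxF p | DiaP p => [:: p]
  | _ => [::]
  end.

Fixpoint subformulas (p : tform) : seq tform :=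
  p :: match p with
  | TAnd p q | TOr p q => subformulas p ++ subformulas q
  | Not p | BoxF p | DiaP p => subformulas p
  | _ => [::]
  end.

Lemma mem_subformulas p : p \in subformulas p.
Proof. by case: p => *; apply: mem_head. Qed.

Lemma subformulas_closed p c d : c \in subformulas p -> d \in immediate c ->
  d \in subformulas p.
Proof.
elim: p => [n|||p IHp q IHq|p IHp q IHq|p IHp|p IHp|p IHp];
  rewrite [subformulas _]/= !inE ?mem_cat.
- by move=> /eqP->.
- by move=> /eqP->.
- by move=> /eqP->.
- move=> /predU1P[-> /[!inE] /orP[]/eqP->|/orP[/IHp sp /sp ->|/IHq sq /sq ->]];
    by rewrite ?mem_subformulas ?orbT.
- move=> /predU1P[-> /[!inE] /orP[]/eqP->|/orP[/IHp sp /sp ->|/IHq sq /sq ->]];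
    by rewrite ?mem_subformulas ?orbT.
- by move=> /predU1P[-> /[!inE] /eqP->|/IHp sp /sp ->]; rewrite ?mem_subformulas ?orbT.
- by move=> /predU1P[-> /[!inE] /eqP->|/IHp sp /sp ->]; rewrite ?mem_subformulas ?orbT.
- by move=> /predU1P[-> /[!inE] /eqP->|/IHp sp /sp ->]; rewrite ?mem_subformulas ?orbT.
Qed.

Definition modal (p : tform) : bool :=
  match p with BoxF _ | DiaP _ => true | _ => false end.

(* Decodes the variable [n] of a boxed combination as the formula it stands for. *)
Definition decode_var (n : nat) : tform := odflt TBot (choice.unpickle n).

(** * Simulating the types of worlds by up-sets *)

Section Reduction.
Variables (W : Type) (R : W -> W -> Prop) (V : nat -> W -> Prop).
Hypothesis preR : preorder_on R.
Let Rxx := preR.1.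
Let Rtr := preR.2.

Definition definable (U : W -> Prop) : Prop :=
  exists p, forall w, U w <-> tval R V p w.

(** Each variable of [p] codes an arbitrary tense formula, so these are the Boolean combinations of
    definable up-sets; the combination before decoding is the one linked to translations. *)
Definition boxed_definable (U : W -> Prop) : Prop :=
  exists2 p, boxed_combination p & forall w, U w <-> tval R V (tsubst decode_var p) w.

Lemma definable_boolean : boolean_class definable.
Proof.
split=> [U U' UU' [p Up]|P|U U' [p Up] [q Uq]|U [p Up]].
- by exists p => w; rewrite -UU'.
- by case: (pselect P) => HP; [exists TTop|exists TBot].
- by exists (TAnd p q) => w; rewrite Up Uq.
- by exists (Not p) => w; rewrite Up.
Qed.

Lemma boxed_definable_boolean : boolean_class boxed_definable.
Proof.
split=> [U U' UU' [p bp Up]|P|U U' [p bp Up] [q bq Uq]|U [p bp Up]].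
- by exists p => // w; rewrite -UU'.
- by case: (pselect P) => HP; [exists TTop|exists TBot].
- by exists (TAnd p q) => /= [|w]; rewrite ?bp // Up Uq.
- by exists (Not p) => // w; rewrite Up.
Qed.

Lemma boxed_definable_definable U : boxed_definable U -> definable U.
Proof. by move=> [p _ Up]; exists (tsubst decode_var p). Qed.

Lemma boxed_definable_boxF U : definable U ->
  boxed_definable (fun w => forall u, R w u -> U u).
Proof.
move=> [p Up]; exists (BoxF (TVar (choice.pickle p))) => // w /=.
by rewrite /decode_var choice.pickleK /=; split=> Uw u /Uw /Up.
Qed.

(* An up-set is its own interior, so [DiaP] may serve as a box. *)
Lemma boxed_definable_diaP U : definable U ->
  boxed_definable (fun w => exists2 u, R u w & U u).
Proof.
move=> [p Up]; have [ext _ _ _] := boxed_definable_boolean.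
apply: ext (boxed_definable_boxF (ex_intro _ (DiaP p) (fun w => iff_refl _))) => w.
split=> [/(_ w (Rxx w))[u uw /Up]|[u uw /Up pu] x wx]; first by exists u.
by exists u => //; apply: Rtr wx.
Qed.

Lemma boxed_definable_diaF U : definable U ->
  boxed_definable (fun w => exists2 u, R w u & U u).
Proof.
move=> defU; have [ext _ _ not] := boxed_definable_boolean.
have [_ _ _ dnot] := definable_boolean.
apply: ext (not _ (boxed_definable_boxF (dnot _ defU))) => w; split.
  by move=> nall; apply: contrapT => nex; apply: nall => u wu Uu; apply: nex; exists u.
by move=> [u wu Uu] all; apply: all Uu.
Qed.

Lemma definable_tval p : definable (tval R V p).
Proof. by exists p. Qed.

Hypothesis grzR : forall U, definable U -> grz_set R U.
Hypothesis grzR' : forall U, definable U -> grz_set (converse R) U.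

Variable At : {fset tform}.
Hypothesis closedAt : forall c d, c \in At -> d \in immediate c -> d \in At.

Definition type_of (w : W) : {fset tform} := [fset c in At | `[< tval R V c w >]]%fset.

Lemma in_type_of c w : c \in At -> (c \in type_of w) <-> tval R V c w.
Proof. by move=> cAt; rewrite !inE cAt /=; split=> [/asboolP|/asboolP]. Qed.

Lemma type_of_powerset w : type_of w \in fpowerset At.
Proof. by rewrite fpowersetE; apply/fsubsetP => c; rewrite !inE => /andP[]. Qed.

Lemma definable_type j : j \in fpowerset At -> definable (fun w => type_of w = j).
Proof.
move=> jAt; have [ext _ _ _] := definable_boolean.
apply: ext (_ : definable (fun w => forall c, c \in At -> (tval R V c w <-> c \in j))).
  move=> w; split=> [eqj|<- c cAt]; last by rewrite in_type_of.
  apply/fsetP => c; apply/idP/idP => [cw|cj].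
    have cAt : c \in At by move: cw; rewrite !inE => /andP[].
    exact/(eqj c cAt)/in_type_of.
  have cAt : c \in At by move: jAt; rewrite fpowersetE => /fsubsetP; apply.
  exact/in_type_of/eqj.
apply: (boolean_class_all definable_boolean) => c _.
apply: (boolean_class_iff definable_boolean); exact: definable_tval.
Qed.

(* At a [settled S j] point, moving along [S] one never leaves the type [j] and
   comes back to it. *)
Definition settled (S : W -> W -> Prop) (j : {fset tform}) (w : W) : Prop :=
  (exists2 x, S w x & type_of x = j) /\
  forall u, S w u -> (exists2 x, S u x & type_of x = j) -> type_of u = j.

(** Three demands on a type offered to [w]: its modal formulae are right, it is realised above [w]
    and so is coherent for the Boolean connectives, and a settled world keeps its own type. Each is
    a Boolean combination of up-sets. *)
Definition candidate (j : {fset tform}) (w : W) : Prop :=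
  [/\ forall c, c \in [seq c <- At | modal c] -> (tval R V c w <-> c \in j),
      exists2 x, R w x & type_of x = j &
      forall i, i \in fpowerset At ->
        settled R i w \/ settled (converse R) i w -> i = j].

(* The type under which [w] is to be simulated: it agrees with [type_of w] on modal
   formulae, and on all of [At] when [w] is settled. Unlike [type_of], it is
   determined by the up-sets containing [w]. *)
Definition simulated_type : W -> {fset tform} :=
  first_match fset0 candidate (fpowerset At).

Lemma settled_type S j w : (forall w, S w w) -> settled S j w -> type_of w = j.
Proof. by move=> Sxx [sees]; apply. Qed.

Lemma candidate_type_of w : candidate (type_of w) w.
Proof.
split=> [c|| i _].
- by rewrite mem_filter => /andP[_ cAt]; split=> /(in_type_of _ cAt).
- by exists w.
- by case=> /settled_type ->.
Qed.

Lemma simulated_candidate w : candidate (simulated_type w) w.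
Proof. exact: first_matchP (type_of_powerset w) (candidate_type_of w). Qed.

Lemma boxed_definable_settledF j : j \in fpowerset At -> boxed_definable (settled R j).
Proof.
move=> /definable_type defj; have [_ _ and _] := boxed_definable_boolean.
have sees := boxed_definable_diaF defj; apply: and (sees) _.
apply: boxed_definable_boxF; apply: (boolean_class_imp definable_boolean) defj.
exact: boxed_definable_definable.
Qed.

Lemma boxed_definable_settledP j :
  j \in fpowerset At -> boxed_definable (settled (converse R) j).
Proof.
move=> /definable_type defj; have [ext _ and not] := boxed_definable_boolean.
have sees := boxed_definable_diaP defj; apply: and (sees) _.
have [_ _ _ dnot] := definable_boolean.
(* The past box inside [settled] is rewritten as a negated past diamond, the diamond being an
   up-set. *)
have := boxed_definable_diaP (dnot _ (boolean_class_imp definable_boolean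
  (boxed_definable_definable sees) defj)).
move=> /not; apply: ext => w; split=> [nex u wu|all [u uw]]; last by apply; apply: all.
by apply: contrapT => nu; apply: nex; exists u.
Qed.

Lemma boxed_definable_candidate j :
  j \in fpowerset At -> boxed_definable (candidate j).
Proof.
move=> jAt; have bK := boxed_definable_boolean; have [ext cst and _] := bK.
apply: ext (_ : boxed_definable (fun w =>
    (forall c, c \in [seq c <- At | modal c] -> (tval R V c w <-> c \in j)) /\
    ((exists2 x, R w x & type_of x = j) /\
     forall i, i \in fpowerset At ->
       settled R i w \/ settled (converse R) i w -> i = j))).
  by move=> w; split=> [[? []]|[]].
apply: (and _ _).
  apply: (boolean_class_all bK) => c; rewrite mem_filter => /andP[mc _].
  apply: (boolean_class_iff bK); case: c mc => // p _.
  - exact: boxed_definable_boxF (definable_tval p).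
  - exact: boxed_definable_diaP (definable_tval p).
apply: and; first exact/boxed_definable_diaF/definable_type.
apply: (boolean_class_all bK) => i iAt; apply: (boolean_class_imp bK) (cst _).
by apply: (boolean_class_or bK); [apply: boxed_definable_settledF|apply: boxed_definable_settledP].
Qed.

Lemma boxed_definable_simulated (P : {fset tform} -> Prop) :
  boxed_definable (fun w => P (simulated_type w)).
Proof.
apply: first_match_class; first exact: boxed_definable_boolean.
exact: boxed_definable_candidate.
Qed.

(** The Grzegorczyk property of the type of [w] leads to a settled world of that type, where the
    last demand on candidates leaves no other choice. [S] will be [R] or its converse. *)
Lemma simulated_settled S w : (forall x, S x x) ->
  (forall U, definable U -> grz_set S U) ->
  (forall j x, settled S j x -> settled R j x \/ settled (converse R) j x) ->
  exists2 u, S w u & simulated_type u = type_of w.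
Proof.
move=> Sxx grzS settledS.
have [u [wu typeu clos]] := grzS _ (definable_type (type_of_powerset w)) w erefl.
exists u => //; have [_ _ only] := simulated_candidate u.
by rewrite -(only _ (type_of_powerset w)) //; apply: settledS; split=> //; exists u.
Qed.

(** In the Boolean cases a simulated type behaves well because it is the type of an actual world;
    the modal cases also need settled worlds. *)
Lemma simulated_truth p w : p \in At ->
  tval R (fun n w => TVar n \in simulated_type w) p w <-> p \in simulated_type w.
Proof.
have sim_modal c x : c \in At -> modal c -> c \in simulated_type x <-> tval R V c x.
  by move=> cAt mc; have [+ _ _] := simulated_candidate x => <- //; rewrite mem_filter mc.
have sim_type x : exists2 y, R x y & type_of y = simulated_type x.
  by have [] := simulated_candidate x.
elim: p w => [n|||p IHp q IHq|p IHp q IHq|p IHp|p IHp|p IHp] w pAt;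
  have sub d := closedAt (d := d) pAt.
- by [].
- by have [y _ <-] := sim_type w; rewrite in_type_of.
- by have [y _ <-] := sim_type w; rewrite in_type_of.
- rewrite /= IHp ?IHq; try by apply: sub; rewrite !inE eqxx ?orbT.
  have [y _ <-] := sim_type w.
  by rewrite !in_type_of //; apply: sub; rewrite !inE eqxx ?orbT.
- rewrite /= IHp ?IHq; try by apply: sub; rewrite !inE eqxx ?orbT.
  have [y _ <-] := sim_type w.
  by rewrite !in_type_of //; apply: sub; rewrite !inE eqxx ?orbT.
- have pin : p \in At by apply: sub; rewrite !inE.
  by rewrite /= IHp //; have [y _ <-] := sim_type w; rewrite !in_type_of.
- have pin : p \in At by apply: sub; rewrite !inE.
  rewrite sim_modal //=; split=> pw u wu.
    (* Above [u] lies a world whose simulated type is the type of [u], so truth in the simulation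
       passes to [u]. *)
    have [x ux simx] := @simulated_settled R u Rxx grzR (fun j x h => or_introl h).
    by apply/in_type_of => //; rewrite -simx; apply/IHp => //; apply: pw; apply: Rtr ux.
  (* Conversely, the simulated type of [u] is realised above [u], where [p] holds. *)
  apply/IHp => //; have [y uy <-] := sim_type u.
  by apply/in_type_of => //; apply: pw; apply: Rtr uy.
- have pin : p \in At by apply: sub; rewrite !inE.
  rewrite sim_modal //=; split=> [[u uw /IHp pu]|[u uw pu]].
    (* The world [y] realising the simulated type of [u] lies above [u] and need not lie below [w].
       Reflexivity gives [DiaP p] at [y]; being modal, this formula transfers to [u], which is below
       [w]. *)
    have [y uy typey] := sim_type u.
    have : DiaP p \in simulated_type u.
      rewrite -typey; apply/in_type_of => //; exists y => //.
      by apply/in_type_of => //; rewrite typey; apply: pu.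
    by move=> /sim_modal[] // x xu px; exists x => //; apply: Rtr uw.
  (* Here the settled world is sought downwards, so that it stays below [w]. *)
  have [x xu simx] := @simulated_settled (converse R) u Rxx grzR' (fun j x h => or_intror h).
  exists x; first exact: Rtr uw.
  by apply/IHp => //; rewrite simx; apply/in_type_of.
Qed.
End Reduction.

(** A variable is replaced by the combination saying that the simulated type contains it. The
    substitution is split in two: [t] yields boxed combinations, for which translations are
    available, and [decode_var] restores the formulae under the boxes. *)
Lemma GRZT_reduction (s : seq tform) : exists2 t, forall n, boxed_combination (t n) &
  forall p, p \in s ->
    GRZT (tiff (BoxF p) (BoxF (tsubst decode_var (tsubst t p)))).
Proof.
have GT : tense_logic GRZT := smallest_tense_logic _.
have [W [R [V [preR complete]]]] := tense_logic_model GT.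
have grz_ax p : [set grzF; grzP] p -> GRZT p.
  by move=> ax; apply: sub_gen_smallest; right.
have [[sb _ _ _] _] := GT.
have grzR U : definable R V U -> grz_set R U.
  (* [grzF] constrains the complement of its variable, hence the instance with [Not p]. *)
  move=> [p Up]; have := sb (fun=> Not p) _ (grz_ax grzF (or_introl erefl)).
  move=> /complete valid w Uw.
  have /(tval_grzF _ preR) grz : forall w, tval R (fun=> tval R V (Not p)) grzF w.
    by move=> x; apply/tval_subst.
  have [|u [wu /= nnpu clos]] := grz w; first by move=> /=; apply; apply/Up.
  exists u; split=> //; first by apply/Up; apply: contrapT.
  move=> x ux [y xy Uy]; apply/Up; apply: contrapT; apply: (clos x ux).
  by exists y => //; apply; apply/Up.
have grzR' U : definable R V U -> grz_set (converse R) U.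
  move=> [p Up]; have := sb (fun=> p) _ (grz_ax grzP (or_intror erefl)).
  move=> /complete valid w /Up pw.
  have /tval_grzP grz : forall w, tval R (fun=> tval R V p) grzP w.
    by move=> x; apply/tval_subst.
  have [u [wu /Up Uu clos]] := grz w pw.
  exists u; split=> // x ux [y xy /Up py]; apply/Up; apply: (clos x ux).
  by exists y.
pose At : {fset tform} := [fset c in flatten [seq subformulas (BoxF p) | p <- s]]%fset.
have closedAt c d : c \in At -> d \in immediate c -> d \in At.
  rewrite !inE => /flatten_mapP[p ps cp] dc; apply/flatten_mapP; exists p => //.
  exact: subformulas_closed dc.
have /choice[t tP] : forall n, exists t, boxed_combination t /\ forall w,
    (TVar n \in simulated_type R V At w) <-> tval R V (tsubst decode_var t) w.
  move=> n.
  have [t bt tP] := boxed_definable_simulated V preR At (fun j => TVar n \in j).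
  by exists t.
exists t => [n|p ps]; first by have [] := tP n.
have pAt : BoxF p \in At.
  by rewrite inE; apply/flatten_mapP; exists p => //; apply: mem_subformulas.
apply/complete => w; apply/tval_tiff.
have truth := simulated_truth preR grzR grzR' closedAt w pAt.
have [mod _ _] := simulated_candidate V preR At w.
(* [BoxF p] is modal, so its truth at [w] is membership in the simulated type, that is, truth under
   the simulated valuation. *)
rewrite (mod (BoxF p)) ?mem_filter // -truth -[BoxF (tsubst _ _)]/(tsubst decode_var (tsubst t (BoxF p))).
rewrite tsubst_comp tval_subst //.
suff -> : (fun n w => is_true (TVar n \in simulated_type R V At w)) =
    (fun n => tval R V (tsubst decode_var (t n))) by [].
by apply/funext => n; apply/funext => x; apply/propext; have [] := tP n.
Qed.

(** * The Blok-Esakia isomorphisms *)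

(** Necessitation and the reflexivity axiom make [p] and [BoxF p] interderivable as rules, which is
    weaker than equivalence. *)
Lemma boxF_rule_equiv M p q : tense_rule_system M -> theorems M (tiff (BoxF p) q) ->
  M ([fset p], [fset q])%fset /\ M ([fset q], [fset p])%fset.
Proof.
move=> MC Mpq; have [rsM _ _ nF _] := MC; have logicM := theorems_tense MC.
split; last first.
  apply: (rule_cut_right rsM (_ : M ([fset q], [fset BoxF p])%fset)).
    apply: tense_rule_mp => //; apply: tense_taut1 Mpq => // v /= /andP[]//.
  move=> _ /fset1P->; apply: tense_rule_mp => //; apply: logicM.2.
  by move=> L [_]; apply; constructor.
apply: (rule_cut_right rsM (nF p)) => _ /fset1P->.
by apply: tense_rule_mp => //; apply: tense_taut1 Mpq => // v /= /andP[].
Qed.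

Lemma boxF_logic_equiv M p q : tense_logic M -> M (tiff (BoxF p) q) -> M p <-> M q.
Proof.
move=> MC Mpq; have [[_ mp nF _] SM] := MC; split=> [/nF Mp|Mq].
  by apply: mp Mp _; apply: tense_taut1 Mpq => // v /= /andP[].
have Mp : M (BoxF p) by apply: mp Mq _; apply: tense_taut1 Mpq => // v /= /andP[].
by apply: mp Mp _; apply: SM => L [_]; apply; constructor.
Qed.

Lemma NExt_sigma_R L : NExt_R GRZT_R (sigma_R L).
Proof.
split; first exact: smallest_tense_rule_system.
by move=> r Gr; apply: sub_gen_smallest; left.
Qed.

Lemma NExt_sigma L : NExt GRZT (sigma L).
Proof.
split; first exact: smallest_tense_logic.
by move=> p Gp; apply: sub_gen_smallest; left.
Qed.

Lemma GRZT_R_theorem M p : NExt_R GRZT_R M -> GRZT p -> theorems M p.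
Proof. by move=> [_ GM] Gp; apply: GM; apply: sub_gen_smallest; exists p. Qed.

(** Substituting [t] into a rule of [M] gives, up to interderivability, a translated rule, which
    [sigma_R (rho_R M)] therefore contains. There it is turned back into the [t]-instance,
    [decode_var] is applied, and the reduction over GRZ.T recovers [r]. *)
Lemma sigma_R_rho_R M : NExt_R GRZT_R M -> sigma_R (rho_R M) = M.
Proof.
move=> MG; have [MC GM] := MG; apply/seteqP; split.
  by apply: smallest_sub => // r [/GM //|[q Mq <-]].
move=> r Mr; set N := sigma_R (rho_R M).
have NG : NExt_R GRZT_R N by exact: NExt_sigma_R.
have [NC _] := NG; have [rsM _ _ _ _] := MC; have [rsN _ _ _ _] := NC.
(* One [t] must serve all premises and conclusions, as a rule is substituted uniformly. *)
have [t bt red] := GRZT_reduction (enum_fset r.1 ++ enum_fset r.2).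
have /choice[a aP] p := boxed_combination_Tr p bt.
have SM p : S4t p -> theorems M p by apply: (theorems_tense MC).2.
have SN p : S4t p -> theorems N p by apply: (theorems_tense NC).2.
have Mt : M (map_rule (tsubst t) r) by case: rsM => sb _ _ _; apply: sb.
have Ma : M (map_rule Tr (map_rule a r)).
  rewrite map_rule_comp; apply: (rule_transfer rsM) Mt => p _ /=;
    by have [] := boxF_rule_equiv MC (SM _ (aP p)).
have Na : N (map_rule Tr (map_rule a r)).
  by apply: sub_gen_smallest; right; exists (map_rule a r).
have Nt : N (map_rule (tsubst t) r).
  rewrite map_rule_comp in Na; apply: (rule_transfer rsN) Na => p _ /=;
    by have [] := boxF_rule_equiv NC (SN _ (aP p)).
have Nd : N (map_rule (tsubst decode_var \o tsubst t) r).
  by rewrite -map_rule_comp; case: rsN => sb _ _ _; apply: sb.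
have equiv p : p \in enum_fset r.1 ++ enum_fset r.2 ->
    N ([fset p], [fset (tsubst decode_var \o tsubst t) p])%fset /\
    N ([fset (tsubst decode_var \o tsubst t) p], [fset p])%fset.
  move=> /red Gp.
  set q := (_ \o _) p.
  have [pbq bqp] := boxF_rule_equiv NC (GRZT_R_theorem NG Gp).
  have [qbq bqq] : N ([fset q], [fset BoxF q])%fset /\ N ([fset BoxF q], [fset q])%fset.
    by apply: boxF_rule_equiv => //; apply: SN; apply: tense_taut S4t_tense _ _ => v /=;
      case: (v _).
  split; [apply: (rule_cut_right rsN pbq)|apply: (rule_cut_right rsN qbq)];
    by move=> _ /fset1P->.
rewrite -[r]map_rule_id; apply: (rule_transfer rsN) Nd => p pr;
  by have [] := equiv p; rewrite // mem_cat pr ?orbT.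
Qed.

Lemma sigma_rho M : NExt GRZT M -> sigma (rho M) = M.
Proof.
move=> [MC GM]; apply/seteqP; split.
  by apply: smallest_sub => // r [/GM //|[q Mq <-]].
move=> p Mp; set N := sigma (rho M).
have [NC GN] : NExt GRZT N by exact: NExt_sigma.
have [t bt /(_ p (mem_head _ _)) red] := GRZT_reduction [:: p].
have [a aP] := boxed_combination_Tr p bt.
have [[sbM _ _ _] SM] := MC; have [[sbN _ _ _] SN] := NC.
have Ma : M (Tr a) by apply/(boxF_logic_equiv MC (SM _ aP))/sbM.
have Na : N (Tr a) by apply: sub_gen_smallest; right; exists a.
have Nt : N (tsubst t p) by apply/(boxF_logic_equiv NC (SN _ aP)).
apply/(boxF_logic_equiv NC (GN _ red)).
by have [[_ _ nF _] _] := NC; apply: nF; apply: sbN.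
Qed.

Theorem theorem4p45 :
  [/\ complete_lattice_isomorphism Ext_biIPC_R (NExt_R GRZT_R) sigma_R,
      complete_lattice_isomorphism (NExt_R GRZT_R) Ext_biIPC_R rho_R,
      forall L, Ext_biIPC_R L -> rho_R (sigma_R L) = L &
      forall M, NExt_R GRZT_R M -> sigma_R (rho_R M) = M]
  /\
  [/\ complete_lattice_isomorphism Ext_biIPC (NExt GRZT) sigma,
      complete_lattice_isomorphism (NExt GRZT) Ext_biIPC rho,
      forall L, Ext_biIPC L -> rho (sigma L) = L &
      forall M, NExt GRZT M -> sigma (rho M) = M].
Proof.
have oplus_mono (U V : Type) (C : set (set V)) (X : set V) (f : U -> V) :
    {homo (fun L => oplus C X (f @` L)) : L L' / L `<=` L'}.
  move=> L L' LL' p oLp K [CK subK]; apply: oLp; split=> // q qin; apply: subK.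
  by case: qin => [|[r /LL' Lr <-]]; [left|right; exists r].
have rho_mono (U V : Type) (f : U -> V) : {homo (preimage f) : L L' / L `<=` L'}.
  by move=> L L' LL' p; apply: LL'.
have mR := NExt_R_meet (X := GRZT_R); have mL := NExt_meet (X := GRZT).
split; split.
- apply: (complete_lattice_isomorphism_inverses (g := rho_R)) => //.
  + exact: Ext_biIPC_R_meet.
  + by move=> L _; apply: NExt_sigma_R.
  + by move=> M [MC _]; apply: rho_R_bsi.
  + exact: oplus_mono.
  + exact: rho_mono.
  + exact: rho_R_sigma_R.
  + exact: sigma_R_rho_R.
- apply: (complete_lattice_isomorphism_inverses (g := sigma_R)) => //.
  + exact: Ext_biIPC_R_meet.
  + by move=> M [MC _]; apply: rho_R_bsi.
  + by move=> L _; apply: NExt_sigma_R.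
  + exact: rho_mono.
  + exact: oplus_mono.
  + exact: sigma_R_rho_R.
  + exact: rho_R_sigma_R.
- exact: rho_R_sigma_R.
- exact: sigma_R_rho_R.
- apply: (complete_lattice_isomorphism_inverses (g := rho)) => //.
  + exact: Ext_biIPC_meet.
  + by move=> L _; apply: NExt_sigma.
  + by move=> M [MC _]; apply: rho_bsi.
  + exact: oplus_mono.
  + exact: rho_mono.
  + exact: rho_sigma.
  + exact: sigma_rho.
- apply: (complete_lattice_isomorphism_inverses (g := sigma)) => //.
  + exact: Ext_biIPC_meet.
  + by move=> M [MC _]; apply: rho_bsi.
  + by move=> L _; apply: NExt_sigma.
  + exact: rho_mono.
  + exact: oplus_mono.
  + exact: sigma_rho.
  + exact: rho_sigma.
- exact: rho_sigma.
- exact: sigma_rho.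
Qed.
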